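(* Let $\alpha\in[-1,1)$. In the canonical normal linear prediction model, with the hierarchical prior $\pi(\theta,\mu,\eta)$ depending on $\alpha$, $a$, $C$, $\gamma$ (model and prior are described in the context; $a>-k/2-1$, $c_i\ge 1$ for all $i$, $\gamma\ge 1$), the generalized Bayes predictive density under $D_\alpha$ divergence with respect to this prior is, as a function of $\tilde y\in\mathbb{R}^m$ and up to a normalizing factor not depending on $\tilde y$, $$\hat p_\alpha(\tilde y|y)\ \propto\ \hat p_{\{U,\alpha\}}(\tilde y|y)\times\check p_\alpha(\tilde y|y),$$ where $$\hat p_{\{U,\alpha\}}(\tilde y|y)=\left\{(\tilde y-Qv)'\Sigma_U^{-1}(\tilde y-Qv)+s\right\}^{-m/2-(n-k)/(1-\alpha)},$$ $$\check p_\alpha(\tilde y|y)=\left\{(\tilde y-Q\hat\theta_B)'\Sigma_B^{-1}(\tilde y-Q\hat\theta_B)+R(v)+\frac{\|v_*\|^2}{\gamma}+s\right\}^{-\frac{k+2a+2}{1-\alpha}},$$ and $$\Sigma_U=\tfrac{2}{1-\alpha}I_m+QDQ',\qquad \hat\theta_B=(C-I_l)\left(C+\tfrac{1-\alpha}{2}D\right)^{-1}v,$$ $$\Sigma_B=\tfrac{2}{1-\alpha}I_m+Q(C-I_l)D\left(C+\tfrac{1-\alpha}{2}D\right)^{-1}Q',$$ $$R(v)=v'\left(\tfrac{1-\alpha}{2}D+I_l\right)D^{-1}\left(C+\tfrac{1-\alpha}{2}D\right)^{-1}v.$$ When $m\ge k$ the term $\|v_*\|^2/\gamma$ is omitted.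
   Context: Canonical model. Let $n>k\ge1$ and $m\ge1$ be integers and $l=\min(k,m)$. One observes independent $$V\sim N_l(\theta,\eta^{-1}D),\qquad V_*\sim N_{k-l}(\mu,\eta^{-1}I_{k-l}),\qquad \eta S\sim\chi^2_{n-k},$$ where $\theta\in\mathbb{R}^l$, $\mu\in\mathbb{R}^{k-l}$ and $\eta=\sigma^{-2}>0$ are unknown, and $D=\mathrm{diag}(d_1,\dots,d_l)$ is known with $d_1\ge\dots\ge d_l>0$. When $m\ge k$ (so $l=k$), $V_*$ and $\mu$ are empty. The future observation is $\tilde Y\sim N_m(Q\theta,\eta^{-1}I_m)$, conditionally independent of $(V,V_*,S)$ given the parameters, where $Q$ is a known $m\times l$ matrix with $Q'Q=I_l$. A prime denotes transpose. The observed values are $(v,v_*,s)$, and ''$|y$'' means conditioning on $(v,v_*,s)$. Write $\psi=(\theta,\mu,\eta)$ and $p(\tilde y|\psi)$ for the density of $\tilde Y$. Prior. For $\alpha\in[-1,1]$ the (possibly improper) prior density $\pi(\theta,\mu,\eta)$ is given hierarchically by $$\theta|\eta,\lambda\sim N_l\left(0,\eta^{-1}\left(D^{-1}+\tfrac{1-\alpha}{2}I_l\right)^{-1}(C/\lambda-I_l)\right),\qquad \mu|\eta,\lambda\sim N_{k-l}\left(0,\eta^{-1}(\gamma/\lambda-1)I_{k-l}\right),$$ with $\theta$ and $\mu$ conditionally independent given $(\eta,\lambda)$, and with $\eta$ having (improper) density proportional to $\eta^a$ on $(0,\infty)$ and $\lambda$ having density proportional to $\lambda^a(1-\lambda)^b$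 on $(0,1)$; i.e. $\pi(\theta,\mu,\eta)$ is the integral over $\lambda\in(0,1)$ of the product of the two conditional normal densities with $\eta^a\lambda^a(1-\lambda)^b$. Here $C=\mathrm{diag}(c_1,\dots,c_l)$ with $c_i\ge1$, $b=(1-\alpha)m/4+(n-k)/2-1$, $\gamma\ge1$, and $a>-k/2-1$. When $m\ge k$ the prior on $\mu$ is empty. Divergence loss and generalized Bayes predictive density. The $\alpha$-divergence is $D_\alpha\{\hat p,p\}=\int f_\alpha\left(\hat p(\tilde y;y)/p(\tilde y|\psi)\right)p(\tilde y|\psi)\,d\tilde y$ with $f_\alpha(z)=\frac{4}{1-\alpha^2}(1-z^{(1+\alpha)/2})$ for $|\alpha|<1$, $f_1(z)=z\log z$, $f_{-1}(z)=-\log z$. For $\alpha\ne1$, the generalized Bayes predictive density under $D_\alpha$ with respect to $\pi$ is the probability density in $\tilde y$ proportional to $$\left[\int p(\tilde y|\psi)^{(1-\alpha)/2}\,\pi(\psi|y)\,d\psi\right]^{2/(1-\alpha)},$$ where $\pi(\psi|y)\propto p(v|\theta,\eta)p(v_*|\mu,\eta)p(s|\eta)\pi(\theta,\mu,\eta)$ is the posterior. *)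

(* Defs.v *)
From HB Require Import structures.
From mathcomp Require Export all_boot all_order all_algebra.
From mathcomp Require Export all_classical all_reals all_analysis.

Set Implicit Arguments.
Unset Strict Implicit.
Unset Printing Implicit Defensive.

Import Order.TTheory GRing.Theory Num.Theory.
Import numFieldNormedType.Exports.

Local Open Scope classical_set_scope.
Local Open Scope ring_scope.

Section tuple_measure.
Context d (T : measurableType d) (R : realType).

Definition tuple_cons n (p : T * n.-tuple T) : n.+1.-tuple T :=
  [tuple of p.1 :: p.2].

Lemma measurable_tuple_cons n : measurable_fun setT (@tuple_cons n).
Proof.
by apply: measurable_cons; [exact: measurable_fst|exact: measurable_snd].
Qed.

(* The n-th power of mu, for the product sigma-algebra on n-tuples. *)
Fixpoint tuple_measure (mu : set T -> \bar R) n : set (n.-tuple T) -> \bar R :=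
  match n with
  | 0 => dirac [tuple]
  | n'.+1 => pushforward (mu \x @tuple_measure mu n')%E (@tuple_cons n')
  end.
Arguments tuple_measure mu n : clear implicits.

Section step.
Variable mu : {sigma_finite_measure set T -> \bar R}.
Variables (n : nat) (nu : {sigma_finite_measure set (n.-tuple T) -> \bar R}).

Definition tuple_measureS : set (n.+1.-tuple T) -> \bar R :=
  pushforward (mu \x nu)%E (@tuple_cons n).

Let step0 : tuple_measureS set0 = 0%E.
Proof. by rewrite /tuple_measureS /pushforward preimage_set0 measure0. Qed.

Let step_ge0 A : (0 <= tuple_measureS A)%E.
Proof. by rewrite /tuple_measureS /pushforward. Qed.

Let step_additive : semi_sigma_additive tuple_measureS.
Proof.
move=> F mF tF mUF; rewrite /tuple_measureS /pushforward preimage_bigcup.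
have mc := @measurable_tuple_cons n.
apply: measure_semi_sigma_additive.
- by move=> i; rewrite -[X in measurable X]setTI; exact: mc.
- apply/trivIsetP => /= i j _ _ ij; rewrite -preimage_setI.
  by move/trivIsetP : tF => /(_ _ _ _ _ ij) ->//; rewrite preimage_set0.
- by rewrite -preimage_bigcup -[X in measurable X]setTI; exact: mc.
Qed.

HB.instance Definition _ := isMeasure.Build _ _ _ tuple_measureS
  step0 step_ge0 step_additive.

Let step_sigma_finite : sigma_finite setT tuple_measureS.
Proof.
have /sigma_finiteP[F [TF ndF Foo]] := sigma_finiteT mu.
have /sigma_finiteP[G [TG ndG Goo]] := sigma_finiteT nu.
pose split (t : n.+1.-tuple T) := (thead t, [tuple of behead t]).
have msplit : measurable_fun setT split.
  apply/measurable_fun_pairP; split; first exact: measurable_tnth.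
  exact: measurable_behead.
have splitK : cancel (@tuple_cons n) split.
  by move=> [x t]; rewrite /split /tuple_cons /=; congr pair; apply: val_inj.
exists (fun i => split @^-1` (F i `*` G i)).
  rewrite -preimage_bigcup -[LHS](preimage_setT split) -setXTT TF TG.
  congr preimage; apply/seteqP; split => [[x y] /= [[i _ Fi] [j _ Gj]]|].
    exists (maxn i j) => //; split => /=.
      by move: x Fi; exact/subsetPset/ndF/leq_maxl.
    by move: y Gj; exact/subsetPset/ndG/leq_maxr.
  by move=> [x y] [i _ [/= Fi Gi]]; split; exists i.
move=> i; have [mF oF] := Foo i; have [mG oG] := Goo i; split.
  by rewrite -[X in measurable X]setTI; apply: msplit => //; exact: measurableX.
rewrite /tuple_measureS /pushforward -comp_preimage.
have -> : split \o @tuple_cons n = id by apply/funext => p; exact: splitK.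
by rewrite preimage_id product_measure1E// lte_mul_pinfty// ge0_fin_numE.
Qed.

HB.instance Definition _ := Measure_isSigmaFinite.Build _ _ _ tuple_measureS
  step_sigma_finite.

End step.

Section instances.
Variable mu : {sigma_finite_measure set T -> \bar R}.

Lemma tuple_measureP n :
  exists nu : {sigma_finite_measure set (n.-tuple T) -> \bar R},
    tuple_measure mu n = nu.
Proof.
elim: n => [|n [nu IH]] /=.
  by exists (dirac [tuple] : {sigma_finite_measure set (0.-tuple T) -> \bar R}).
by exists (tuple_measureS mu nu); rewrite IH.
Qed.

Variable n : nat.

Let power0 : tuple_measure mu n set0 = 0%E.
Proof. by have [nu ->] := tuple_measureP n; rewrite measure0. Qed.

Let power_ge0 A : (0 <= tuple_measure mu n A)%E.
Proof. by have [nu ->] := tuple_measureP n. Qed.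

Let power_additive : semi_sigma_additive (tuple_measure mu n).
Proof.
by have [nu ->] := tuple_measureP n; exact: measure_semi_sigma_additive.
Qed.

HB.instance Definition _ := isMeasure.Build _ _ _ (tuple_measure mu n)
  power0 power_ge0 power_additive.

Let power_sigma_finite : sigma_finite setT (tuple_measure mu n).
Proof. by have [nu ->] := tuple_measureP n; exact: sigma_finiteT. Qed.

HB.instance Definition _ := Measure_isSigmaFinite.Build _ _ _
  (tuple_measure mu n) power_sigma_finite.

End instances.

End tuple_measure.
Arguments tuple_measure {d T R} mu n.

Section densities.
Context {R : realType}.
Implicit Types (eta : R) (n : nat).

(* Lebesgue integral over R^n, the points being column vectors. For n = 0 it
   is evaluation at the empty vector. *)
Definition integral_cV n (f : 'cV[R]_n -> \bar R) : \bar R :=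
  (\int[tuple_measure (@lebesgue_measure R) n]_t f (\col_i tnth t i))%E.

Definition qform n (M : 'M[R]_n) (x : 'cV[R]_n) : R :=
  (x^T *m M *m x) ord0 ord0.

Definition normal_density n (mean : 'cV[R]_n) (Sigma : 'M[R]_n)
    (x : 'cV[R]_n) : R :=
  (2 * pi) `^ (- (n%:R / 2)) * (\det Sigma) `^ (- (1 / 2)) *
  expR (- (1 / 2) * qform (invmx Sigma) (x - mean)).

Definition Gamma (x : R) : R :=
  fine (\int[lebesgue_measure]_(t in `]0%R, +oo[)
          (t `^ (x - 1) * expR (- t))%:E)%E.

Definition chi2_density (nu : nat) (x : R) : R :=
  if 0 < x then
    x `^ (nu%:R / 2 - 1) * expR (- (x / 2)) /
    (2 `^ (nu%:R / 2) * Gamma (nu%:R / 2))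
  else 0.

End densities.

Section model.
Context {R : realType}.
Variables (n k m l : nat).
Variables (d : 'rV[R]_l) (Q : 'M[R]_(m, l)).

Local Notation D := (diag_mx d).

Definition density_v (theta : 'cV[R]_l) (eta : R) (v : 'cV[R]_l) : R :=
  normal_density theta (eta^-1 *: D) v.

Definition density_vstar (mu : 'cV[R]_(k - l)) (eta : R)
    (vstar : 'cV[R]_(k - l)) : R :=
  normal_density mu (eta^-1 *: 1%:M) vstar.

(* eta * S follows a chi-square law with n - k degrees of freedom. *)
Definition density_s (eta s : R) : R := eta * chi2_density (n - k) (eta * s).

Definition density_y (theta : 'cV[R]_l) (eta : R) (y : 'cV[R]_m) : R :=
  normal_density (Q *m theta) (eta^-1 *: 1%:M) y.

Variables (alpha a : R) (c : 'rV[R]_l) (gamma : R).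

Local Notation C := (diag_mx c).
Local Notation beta := ((1 - alpha) / 2).

Definition prior_b : R := (1 - alpha) * m%:R / 4 + (n - k)%:R / 2 - 1.

Definition prior_theta (eta lambda : R) (theta : 'cV[R]_l) : R :=
  normal_density 0
    (eta^-1 *: (invmx (invmx D + beta%:M) *m (lambda^-1 *: C - 1%:M))) theta.

Definition prior_mu (eta lambda : R) (mu : 'cV[R]_(k - l)) : R :=
  normal_density 0 (eta^-1 *: (gamma / lambda - 1)%:M) mu.

(* Extended-real valued: when some c_i or gamma equals 1 the integral over
   lambda may diverge on a null set of parameters. *)
Definition prior (theta : 'cV[R]_l) (mu : 'cV[R]_(k - l)) (eta : R) : \bar R :=
  (\int[lebesgue_measure]_(lambda in `]0%R, 1%R[)
     (prior_theta eta lambda theta * prior_mu eta lambda mu *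
      eta `^ a * (lambda `^ a * (1 - lambda) `^ prior_b))%:E)%E.

(* Integral over R^l * R^(k-l) * (0, +oo), iterated: by Tonelli's theorem this
   is the integral for the product measure when f is nonnegative. *)
Definition integral_psi
    (f : 'cV[R]_l -> 'cV[R]_(k - l) -> R -> \bar R) : \bar R :=
  integral_cV (fun theta => integral_cV (fun mu =>
    (\int[lebesgue_measure]_(eta in `]0%R, +oo[) f theta mu eta)%E)).

Variables (v : 'cV[R]_l) (vstar : 'cV[R]_(k - l)) (s : R).

Definition likelihood_prior (theta : 'cV[R]_l) (mu : 'cV[R]_(k - l)) (eta : R) :
    \bar R :=
  ((density_v theta eta v * density_vstar mu eta vstar * density_s eta s)%:E *
   prior theta mu eta)%E.

Definition posterior (theta : 'cV[R]_l) (mu : 'cV[R]_(k - l)) (eta : R) :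
    \bar R :=
  (likelihood_prior theta mu eta / integral_psi likelihood_prior)%E.

Definition bayes_kernel (y : 'cV[R]_m) : \bar R :=
  (integral_psi (fun theta mu eta =>
     (density_y theta eta y `^ ((1 - alpha) / 2))%:E *
     posterior theta mu eta) `^ (2 / (1 - alpha)))%E.

(* Generalized Bayes predictive density under the alpha-divergence,
   for alpha <> 1: bayes_kernel normalized to have integral 1. With the
   conventions for inversion in \bar R, a value in ]0, +oo[ at every y forces
   the integral of bayes_kernel, and likewise that of likelihood_prior, to be
   positive and finite. *)
Definition bayes_predictive (y : 'cV[R]_m) : \bar R :=
  (bayes_kernel y / integral_cV bayes_kernel)%E.

Definition Sigma_U : 'M[R]_m := (2 / (1 - alpha))%:M + Q *m D *m Q^T.

Definition predictive_U (y : 'cV[R]_m) : R :=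
  (qform (invmx Sigma_U) (y - Q *m v) + s)
    `^ (- (m%:R / 2) - (n - k)%:R / (1 - alpha)).

Definition theta_B : 'cV[R]_l :=
  (C - 1%:M) *m invmx (C + beta *: D) *m v.

Definition Sigma_B : 'M[R]_m :=
  (2 / (1 - alpha))%:M +
  Q *m (C - 1%:M) *m D *m invmx (C + beta *: D) *m Q^T.

Definition R_v : R :=
  qform ((beta *: D + 1%:M) *m invmx D *m invmx (C + beta *: D)) v.

(* When l = k, vstar is the empty vector and its squared norm is 0. *)
Definition predictive_check (y : 'cV[R]_m) : R :=
  (qform (invmx Sigma_B) (y - Q *m theta_B) + R_v +
   (\sum_i vstar i ord0 ^+ 2) / gamma + s)
    `^ (- ((k%:R + 2 * a + 2) / (1 - alpha))).

End model.

(* Main.v *)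
(** Rotating the future observation to z = Q'y, everything is diagonal.
    Conditionally on (eta, lambda) the parameters integrate out one Gaussian
    coordinate at a time; completing the square, the prior precisions are chosen
    such that the i-th coordinate leaves
      sqrt (eta * lambda) * exp (- eta * (p_i + lambda * r_i) / 2)
    with p_i, r_i quadratic in (v_i, z_i).  What remains is
      eta^(a1+a2-1) * lambda^(a1-1) * (1-lambda)^(a2-1)
        * exp (- eta * (p + lambda * r)),
    and x = eta * lambda turns its integral into a product of two Gamma
    integrals, p^(-a2) * (p + r)^(-a1): the factor p gives the first predictive
    factor and p + r the second.  The evidence and the normalizing integral are
    finite by comparison with a Gamma-Beta integral and a Student integral. *)

From HB Require Import structures.
Require Import Defs.
From mathcomp Require Import ring lra measurable_realfun.

Set Implicit Arguments.
Unset Strict Implicit.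
Unset Printing Implicit Defensive.

Import Order.TTheory GRing.Theory Num.Theory.
Import numFieldNormedType.Exports.

Local Open Scope classical_set_scope.
Local Open Scope ring_scope.

(** * Lebesgue integration *)

(** In [bayes_kernel] the integral over lambda is innermost, inside an extended-real [prior] that
    may be infinite at some parameters. So everything is rewritten as an integral of nonnegative
    real functions of w = (eta, lambda), and Tonelli moves theta and mu inside. The Gaussian
    formulas hold only for eta > 0 and 0 < lambda < 1; the indicator of this strip therefore travels
    with the weight [base_fun]. The prior variance is tuned as follows. In units of eta, likelihood
    and future observation give coordinate i the precision 1/d_i + beta; adding the prior yields
    (1/d_i + beta) c_i / (c_i - lambda), whose reciprocal is affine in lambda. This is what makes
    the exponent affine in lambda. The evidence goes through the same reduction with the future
    observation absent, where this cancellation fails. Only bounds are then derived, which suffice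
    because the evidence is constant in y. The exponent b of the prior is a2 - 1, as the final
    substitution requires, and the outer power 1/beta turns a2 and a1 into the two exponents of the
    statement. *)

Section lebesgue_affine.
Context {R : realType}.
Local Notation mu := (@lebesgue_measure R).

Lemma measurable_affine (a b : R) :
  measurable_fun setT (fun x : measurableTypeR R => a * x + b).
Proof. by apply: measurable_funD => //; exact: mulrl_measurable. Qed.

(** Lebesgue measure is determined by its values on half-open intervals, and a times its image under
    x |-> a x + b has the same values there. *)
Lemma ge0_integral_affine (a b : R) (f : R -> \bar R) : 0 < a ->
  measurable_fun setT f -> (forall x, (0 <= f x)%E) ->
  (\int[mu]_x f x = a%:E * \int[mu]_x f (a * x + b)%R)%E.
Proof.
move=> a0 mf f0.
pose k := NngNum (ltW a0).
pose phi : measurableTypeR R -> measurableTypeR R := fun x => a * x + b.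
have mphi : measurable_fun setT phi by exact: measurable_affine.
pose H := isMeasurableFun.Build _ _ _ _ _ mphi.
pose phim : {mfun measurableTypeR R >-> measurableTypeR R} := HB.pack phi H.
have E (A : set (measurableTypeR R)) : measurable A ->
    mu A = mscale k (pushforward mu phim) A.
  apply: (@lebesgue_measure_unique R (mscale k (pushforward mu phim))).
  move=> _ [[x y]] _ <-.
  have EE : phi @^-1` `]x, y] = `](x - b) / a, (y - b) / a]%classic.
    by apply/seteqP; split=> t /=; rewrite /phi !in_itv/= ltr_pdivrMr//
      ler_pdivlMr// ltrBlDr lerBrDr mulrC.
  transitivity (a%:E * mu (phi @^-1` `]x, y]))%E; last by [].
  rewrite EE.
  rewrite !lebesgue_measure_itv/= !lte_fin ltr_pM2r ?invr_gt0// ltrD2r.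
  case: ifPn => _; rewrite ?mule0// -!EFinD -EFinM; congr EFin.
  by rewrite mulrBr !(mulrC a) !divfK ?gt_eqF//; ring.
rewrite (eq_measure_integral (mscale k (pushforward mu phim))); last first.
  by move=> A mA _; exact: E.
rewrite ge0_integral_mscale// (ge0_integral_pushforward mphi)//.
Qed.

End lebesgue_affine.

Lemma product_measure_sigma_finite d1 d2 (T1 : measurableType d1)
    (T2 : measurableType d2) (R : realType)
    (m1 : {sigma_finite_measure set T1 -> \bar R})
    (m2 : {sigma_finite_measure set T2 -> \bar R}) :
  sigma_finite setT (m1 \x m2)%E.
Proof.
have /sigma_finiteP[F [UF ndF FP]] := sigma_finiteT m1.
have /sigma_finiteP[G [UG ndG GP]] := sigma_finiteT m2.
exists (fun i => F i `*` G i); last first.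
  move=> i; have [mF ooF] := FP i; have [mG ooG] := GP i; split.
    exact: measurableX.
  by rewrite product_measure1E// lte_mul_pinfty// ge0_fin_numE.
apply/esym; rewrite -subTset => -[x y] _.
have [i _ Fx] : (\bigcup_i F i) x by rewrite -UF.
have [j _ Gy] : (\bigcup_i G i) y by rewrite -UG.
(* Both exhaustions are monotone, so the larger index serves both components. *)
exists (maxn i j) => //; split => /=.
  by move: x Fx; exact/subsetPset/ndF/leq_maxl.
by move: y Gy; exact/subsetPset/ndG/leq_maxr.
Qed.

(* The canonical sigma-finite structure of a product of measures is only found
   for subprobabilities. *)
Lemma product_sigma_finiteP d1 d2 (T1 : measurableType d1)
    (T2 : measurableType d2) (R : realType)
    (m1 : {sigma_finite_measure set T1 -> \bar R})
    (m2 : {sigma_finite_measure set T2 -> \bar R}) :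
  exists nu : {sigma_finite_measure set (T1 * T2)%type -> \bar R},
    (m1 \x m2)%E = nu.
Proof.
pose H := Measure_isSigmaFinite.Build _ _ _ (m1 \x m2)%E
  (product_measure_sigma_finite m1 m2).
pose nu : {sigma_finite_measure set (T1 * T2)%type -> \bar R} :=
  HB.pack (m1 \x m2)%E H.
by exists nu.
Qed.

(** * Tonelli for products over coordinates *)

Section tuple_integral.
Context d (T : measurableType d) (R : realType).
Variable mu : {sigma_finite_measure set T -> \bar R}.

Lemma integral_tuple0 (f : 0.-tuple T -> \bar R) :
  measurable_fun setT f ->
  (\int[tuple_measure mu 0]_t f t = f [tuple])%E.
Proof. by move=> mf; rewrite integral_dirac// diracT mul1e. Qed.

Lemma ge0_integral_tupleS n (f : n.+1.-tuple T -> \bar R) :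
  measurable_fun setT f -> (forall t, 0 <= f t)%E ->
  (\int[tuple_measure mu n.+1]_t f t =
   \int[mu]_x \int[tuple_measure mu n]_t f (tuple_cons (x, t)))%E.
Proof.
move=> mf f0; have mc := @measurable_tuple_cons d T n.
have [nu E] := tuple_measureP mu n.
rewrite [tuple_measure mu n.+1]/= E.
rewrite (ge0_integral_pushforward mc)//= (fubini_tonelli1 (f \o @tuple_cons _ T n))//.
- by apply: measurableT_comp.
- by move=> p; exact: f0.
Qed.

Lemma tuple_measureT_gt0 n :
  (0 < mu setT)%E -> (0 < tuple_measure mu n setT)%E.
Proof.
move=> mu0; elim: n => [|n IH]; first by rewrite /= diracT lte01.
have [nu E] := tuple_measureP mu n; rewrite [tuple_measure mu n.+1]/=.
by rewrite E /pushforward preimage_setT -setXTT product_measure1E// mule_gt0// -E.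
Qed.

Lemma measurable_tuple_prod d' (W : measurableType d') n
    (f : 'I_n -> T -> W -> R) :
  (forall i, measurable_fun setT (fun p : T * W => f i p.1 p.2)) ->
  measurable_fun setT
    (fun p : n.-tuple T * W => \prod_(i < n) f i (tnth p.1 i) p.2).
Proof.
move=> mf; apply: measurable_prod => i _.
apply: (measurableT_comp (mf i) (g := fun p : n.-tuple T * W => (tnth p.1 i, p.2))).
apply/measurable_fun_pairP; split => //=.
- exact: (measurableT_comp (measurable_tnth i)).
- exact: measurable_snd.
Qed.

(** Induction on the coordinates: the factor of the first one joins the weight [r], the induction
    hypothesis integrates the others, and Tonelli then exchanges x and w. Nonnegativity and closed
    forms are asked only where [r w != 0], because the coordinate functions are under control only
    on the strip whose indicator sits in [r]. *)
Lemma ge0_tonelli_tuple_prod d' (W : measurableType d')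
    (nu : {sigma_finite_measure set W -> \bar R}) n (r : W -> R)
    (f : 'I_n -> T -> W -> R) (g : 'I_n -> W -> R) :
  measurable_fun setT r -> (forall w, 0 <= r w) ->
  (forall i, measurable_fun setT (fun p : T * W => f i p.1 p.2)) ->
  (forall i x w, r w != 0 -> 0 <= f i x w) ->
  (forall i, measurable_fun setT (g i)) ->
  (forall i w, r w != 0 -> (\int[mu]_x (f i x w)%:E = (g i w)%:E)%E) ->
  (\int[tuple_measure mu n]_t
     \int[nu]_w (r w * \prod_(i < n) f i (tnth t i) w)%:E =
   \int[nu]_w (r w * \prod_(i < n) g i w)%:E)%E.
Proof.
elim: n => [|n IH] in r f g *.
  move=> *; rewrite integral_tuple0.
    by apply: eq_integral => w _; rewrite !big_ord0.
  under eq_fun do under eq_integral do rewrite big_ord0 mulr1.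
  exact: measurable_cst.
move=> mr r0 mf f0 mg fg.
have mrp : measurable_fun setT (fun p : n.+1.-tuple T * W =>
    (r p.2 * \prod_(i < n.+1) f i (tnth p.1 i) p.2)%:E).
  apply/measurable_EFinP/measurable_funM; last exact: measurable_tuple_prod.
  exact: (measurableT_comp mr).
have p0 (t : n.+1.-tuple T) w : 0 <= r w * \prod_(i < n.+1) f i (tnth t i) w.
  have [->|rw0] := eqVneq (r w) 0; first by rewrite mul0r.
  by rewrite mulr_ge0// prodr_ge0// => i _; exact: f0.
rewrite ge0_integral_tupleS; last 2 first.
- apply: (measurable_fun_fubini_tonelli_F _ mrp) => -[t w].
  by rewrite lee_fin p0.
- by move=> t; apply: integral_ge0 => w _; rewrite lee_fin.
under eq_integral => x _.
  under eq_integral => t _.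
    under eq_integral => w _.
      rewrite big_ord_recl {1}/tnth/= mulrA.
      under eq_bigr do rewrite tnthS.
      over.
    over.
  rewrite (IH (fun w => r w * f ord0 x w) (fun i => f (lift ord0 i))
     (fun i => g (lift ord0 i)))//; first last.
  - move=> i w H; apply: fg; apply: contra_neq H => ->; exact: mul0r.
  - move=> i y w H; apply: f0; apply: contra_neq H => ->; exact: mul0r.
  - move=> w; have [->|rw0] := eqVneq (r w) 0; first by rewrite mul0r.
    by rewrite mulr_ge0// f0.
  - apply: measurable_funM => //.
    exact: (measurableT_comp (mf ord0) (pair1_measurable x)).
  over.
rewrite (fubini_tonelli (fun p : T * W => (r p.2 * f ord0 p.1 p.2 *
   \prod_(i < n) g (lift ord0 i) p.2)%:E) _ _)/=; first last.
- move=> -[x w] /=; rewrite lee_fin.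
  have [->|rw0] := eqVneq (r w) 0; first by rewrite !mul0r.
  rewrite !mulr_ge0// ?f0// prodr_ge0// => i _; rewrite -lee_fin -fg//.
  by apply: integral_ge0 => y _; rewrite lee_fin f0.
- apply/measurable_EFinP/measurable_funM; last first.
    by apply: measurable_prod => i _; exact: (measurableT_comp (mg _)).
  by apply: measurable_funM => //; exact: (measurableT_comp mr).
apply: eq_integral => w _.
have [->|rw0] := eqVneq (r w) 0.
  by rewrite mul0r; under eq_integral do rewrite !mul0r; rewrite integral0.
rewrite big_ord_recl mulrA; under eq_integral do rewrite mulrAC EFinM.
rewrite ge0_integralZl_EFin//; last 3 first.
- by move=> x _; rewrite lee_fin f0.
- apply/measurable_EFinP.
  exact: (measurableT_comp (mf ord0) (pair2_measurable w)).
- rewrite mulr_ge0// prodr_ge0// => i _; rewrite -lee_fin -fg//.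
  by apply: integral_ge0 => y _; rewrite lee_fin f0.
by rewrite fg// -EFinM mulrAC.
Qed.

End tuple_integral.

(** * Gamma and Gaussian integrals *)

(** A zero integral would make [f] vanish almost everywhere on [D], so [D] would lie in a null
    set. *)
Lemma ge0_integral_gt0 d (T : measurableType d) (R : realType)
    (mu : {measure set T -> \bar R}) (D : set T) (f : T -> \bar R) :
  measurable D -> (0 < mu D)%E -> measurable_fun D f ->
  (forall x, D x -> 0 < f x)%E -> (0 < \int[mu]_(x in D) f x)%E.
Proof.
move=> mD D0 mf f0; rewrite lt0e integral_ge0 ?andbT; last first.
  by move=> x Dx; exact/ltW/f0.
apply/eqP => I0; have : (\int[mu]_(x in D) `|f x| = 0)%E.
  by rewrite -I0; apply: eq_integral => x /[!inE] Dx; rewrite gee0_abs// ltW// f0.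
move/(ae_eq_integral_abs mu mD mf) => -[N [mN N0 DN]].
suff DsubN : D `<=` N.
  have /(lt_le_trans D0) := le_measure mu (mem_set mD) (mem_set mN) DsubN.
  by move=> /gt_eqF/negP; apply; exact/eqP/N0.
by move=> x Dx; apply: DN => /= /(_ Dx) fx0; have := f0 x Dx; rewrite fx0 ltxx.
Qed.

Section gamma.
Context {R : realType}.
Local Notation mu := (@lebesgue_measure R).

Let bigcup_itvcy0 : \bigcup_n `[(n.+1%:R^-1 : R), +oo[%classic = `]0, +oo[%classic.
Proof.
apply/seteqP; split => [t [n _ /=]|t /=]; rewrite !in_itv/= !andbT.
  by apply: lt_le_trans; rewrite invr_gt0.
move=> t0; exists (Num.truncn t^-1) => //=; rewrite in_itv/= andbT.
by rewrite invf_ple ?posrE// ltW// truncnS_gt.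
Qed.

(* The integrand of Gamma is dominated by the derivative of (t / (1 + t))^x,
   which is bounded. *)
Let ratio (t : R) : R := 1 - (1 + t)^-1.

Let is_derive_ratio (t : R) : 0 < t -> is_derive t 1 ratio ((1 + t) ^- 2).
Proof.
move=> t0; have n0 : 1 + t != 0 by rewrite gt_eqF// addr_gt0.
pose g : R -> R := fun t => 1 + t.
have dg : is_derive t 1 g 1.
  rewrite (_ : g = cst 1 + id)//; apply: is_derive_eq; by rewrite add0r.
have := @is_deriveV R g t 1 1 n0 dg => dV.
rewrite (_ : ratio = cst 1 - (fun t => (g t)^-1))//; apply: is_derive_eq.
by rewrite /g sub0r scaleNr opprK; exact: mulr1.
Qed.

Let ratioE (t : R) : 0 < t -> ratio t = t * (1 + t)^-1.
Proof. by move=> t0; rewrite /ratio; field; rewrite gt_eqF// addr_gt0. Qed.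

Let ratio_gt0 (t : R) : 0 < t -> 0 < ratio t.
Proof. by move=> t0; rewrite ratioE// mulr_gt0// invr_gt0 addr_gt0. Qed.

Let ratio_density (x t : R) := x * ratio t `^ (x - 1) * (1 + t) ^- 2.

Let is_derive_ratio_powR (x t : R) : 0 < t ->
  is_derive t 1 (fun t => ratio t `^ x) (ratio_density x t).
Proof.
move=> t0; rewrite /ratio_density.
apply: (@is_derive1_comp R (@powR R ^~ x) ratio).
- exact: (@is_derive1_powR R x (ratio t) (ratio_gt0 t0)).
- exact: is_derive_ratio.
Qed.

(** The inequality u <= exp u at u = (1 + t) / x, raised to the power x. *)
Let powR_le_expR (x t : R) : 0 < x -> 0 < t ->
  (1 + t) `^ x <= x `^ x * expR (1 + t).
Proof.
move=> x0 t0; have t10 : 0 < 1 + t by rewrite addr_gt0.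
have H : (1 + t) / x <= expR ((1 + t) / x).
  by apply: le_trans (expR_ge1Dx _); rewrite lerDr.
have -> : expR (1 + t) = expR ((1 + t) / x) `^ x.
  by rewrite -expRM divfK ?gt_eqF.
rewrite -powRM ?expR_ge0 ?(ltW x0)//.
apply: ge0_ler_powR; rewrite ?nnegrE ?(ltW x0) ?(ltW t10) ?mulr_ge0 ?expR_ge0 ?(ltW x0)//.
by rewrite -ler_pdivrMl// mulrC.
Qed.

(** Since [ratio_density x t] equals x t^(x-1) (1+t)^(-(x+1)), only a bound on (1+t)^(x+1) exp(-t)
    is needed; [powR_le_expR] at x + 1 gives the constant. *)
Let gamma_le_ratio (x t : R) : 0 < x -> 0 < t ->
  t `^ (x - 1) * expR (- t) <=
  ((x + 1) `^ (x + 1) * expR 1 / x) * ratio_density x t.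
Proof.
move=> x0 t0; have t10 : 0 < 1 + t by rewrite addr_gt0.
rewrite /ratio_density ratioE// powRM ?invr_ge0 ?(ltW t0) ?(ltW t10)//.
have -> : (1 + t)^-1 `^ (x - 1) = ((1 + t) `^ (x + 1))^-1 * (1 + t) ^+ 2.
  rewrite -powR_inv1 ?(ltW t10)// -powRrM -powR_mulrn ?(ltW t10)// -powRN.
  rewrite -powRD; last by rewrite (gt_eqF t10) implybT.
  congr powR; ring.
have e0 := expR_gt0 t.
have := @powR_le_expR (x + 1) t (addr_gt0 x0 ltr01) t0.
rewrite expRD expRN => H.
have p0 : 0 < (1 + t) `^ (x + 1) by exact: powR_gt0.
have -> : (x + 1) `^ (x + 1) * expR 1 / x *
   (x * (t `^ (x - 1) * (((1 + t) `^ (x + 1))^-1 * (1 + t) ^+ 2)) / (1 + t) ^+ 2)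
  = t `^ (x - 1) * ((x + 1) `^ (x + 1) * expR 1 / (1 + t) `^ (x + 1)).
  by field; rewrite !gt_eqF.
apply: ler_wpM2l; first exact: powR_ge0.
by rewrite ler_pdivlMr// mulrC ler_pdivrMr// -mulrA.
Qed.

Lemma Gamma_integral_fin (x : R) : 0 < x ->
  (\int[mu]_(t in `]0%R, +oo[) (t `^ (x - 1) * expR (- t))%:E < +oo)%E.
Proof.
move=> x0.
have cf t : 0 < t -> {for t, continuous (ratio_density x)}.
  move=> t0; apply: differentiable_continuous; apply/derivable1_diffP.
  rewrite /ratio_density.
  have [d1 _] := @is_derive_ratio_powR (x - 1) t t0.
  have n2 : (1 + t) ^+ 2 != 0 by rewrite expf_neq0// gt_eqF// addr_gt0.
  apply: derivableM; last by apply: derivableV.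
  by apply: derivableM.
have mf (D : set R) : D `<=` `]0, +oo[%classic -> measurable D ->
    measurable_fun D (EFin \o ratio_density x).
  move=> D0 mD; apply/measurable_EFinP; apply: (measurable_funS _ D0) => //.
  apply: subspace_continuous_measurable_fun => //.
  apply: continuous_in_subspaceT => t; rewrite inE/= in_itv/= andbT.
  exact: cf.
have f0 t : 0 < t -> 0 <= ratio_density x t.
  move=> t0; rewrite /ratio_density !mulr_ge0 ?powR_ge0 ?(ltW x0)//.
  by rewrite invr_ge0 sqr_ge0.
have itv0 (n : nat) : `[(n.+1%:R^-1 : R), +oo[%classic `<=` `]0, +oo[%classic.
  move=> t /=; rewrite !in_itv/= !andbT; apply: lt_le_trans.
  by rewrite invr_gt0.
have cF t : 0 < t -> {for t, continuous (fun t => ratio t `^ x)}.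
  move=> t0; apply: differentiable_continuous; apply/derivable1_diffP.
  by have [] := is_derive_ratio_powR x t0.
have F1 : ratio t `^ x @[t --> +oo] --> (1 : R).
  have <- : 1 `^ x = 1 :> R by rewrite powR1.
  have c1 : {for 1, continuous (@powR R ^~ x)}.
    apply: differentiable_continuous; apply/derivable1_diffP.
    by have [] := is_derive1_powR x (@ltr01 R).
  apply: (cvg_comp ratio (@powR R ^~ x) _ c1).
  have : ratio t @[t --> +oo] --> (1 - 0 : R); last by rewrite subr0.
  apply: cvgB; first exact: cvg_cst.
  apply/(@gtr0_cvgV0 _ _ _ _ (fun t : R => 1 + t)); last exact: cvg_addrl.
  by near=> t; rewrite addr_gt0.
have intF (n : nat) : (\int[mu]_(t in `[(n.+1%:R^-1)%R, +oo[)
    (ratio_density x t)%:E <= 1)%E.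
  have n0 : 0 < n.+1%:R^-1 :> R by rewrite invr_gt0.
  rewrite (@ge0_continuous_FTC2y R _ (fun t => ratio t `^ x) _ 1)//.
  - by rewrite -EFinB lee_fin gerBl powR_ge0.
  - by move=> t nt; apply: f0; exact: lt_le_trans nt.
  - apply: continuous_in_subspaceT => t; rewrite inE => /itv0.
    by rewrite /= in_itv/= andbT => /cf.
  - move=> t nt.
    by have [] := is_derive_ratio_powR x (lt_trans n0 nt).
  - by apply: cvg_at_right_filter; exact: cF.
  - move=> t; rewrite in_itv/= andbT => nt; rewrite derive1E.
    by have [_] := is_derive_ratio_powR x (lt_trans n0 nt).
have int0 : (\int[mu]_(t in `]0%R, +oo[) (ratio_density x t)%:E <= 1)%E.
  rewrite -bigcup_itvcy0.
  have := @ge0_nondecreasing_set_cvg_integral _ (measurableTypeR R) R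
    (fun n => `[(n.+1%:R^-1 : R), +oo[%classic) (EFin \o ratio_density x) mu.
  move=> H; apply: (cvge_le _ (H _ _ _ _)).
  - by near=> n; exact: intF.
  - move=> p q pq; apply/subsetPset => t /=; rewrite !in_itv/= !andbT.
    by apply: le_trans; rewrite lef_pV2 ?posrE// ler_nat.
  - by [].
  - by move=> i; exact: mf.
  - by move=> i t /itv0; rewrite /= in_itv/= andbT lee_fin => /f0.
apply: (@le_lt_trans _ _ (\int[mu]_(t in `]0%R, +oo[)
  (((x + 1) `^ (x + 1) * expR 1 / x)%:E * (ratio_density x t)%:E))%E).
  apply: ge0_le_integral => //=.
  - by move=> t _; rewrite lee_fin mulr_ge0 ?powR_ge0 ?expR_ge0.
  - apply/measurable_EFinP/measurable_funTS/measurable_funM => //.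
    by apply: measurableT_comp => //; exact: oppr_measurable.
  - apply/measurable_EFinP/measurable_funM; first exact: measurable_cst.
    by apply/measurable_EFinP; apply: mf.
  - move=> t; rewrite in_itv/= andbT => t0; rewrite -EFinM lee_fin.
    exact: gamma_le_ratio.
rewrite ge0_integralZl_EFin//=.
- by apply: lte_mul_pinfty => //; rewrite ?lee_fin ?mulr_ge0 ?powR_ge0
    ?expR_ge0 ?invr_ge0 ?(ltW x0)// (le_lt_trans int0)// ltry.
- by move=> t; rewrite in_itv/= andbT lee_fin => /f0.
- exact: mf.
- by rewrite ?mulr_ge0 ?powR_ge0 ?expR_ge0 ?invr_ge0 ?(ltW x0).
Unshelve. all: by end_near.
Qed.

End gamma.

Section gamma_beta.
Context {R : realType}.
Local Notation mu := (@lebesgue_measure R).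
Implicit Types p q : R.

(** Unnormalized Gamma density of shape [p] and rate [q], extended by zero so that affine
    substitutions and convolutions run over the whole line. *)
Definition gamma_fun p q (t : R) : R :=
  \1_`]0, +oo[ t * (t `^ (p - 1) * expR (- (q * t))).

Lemma gamma_fun_ge0 p q t : 0 <= gamma_fun p q t.
Proof. by rewrite /gamma_fun !mulr_ge0 ?powR_ge0 ?expR_ge0. Qed.

Lemma gamma_funE p q t : 0 < t ->
  gamma_fun p q t = t `^ (p - 1) * expR (- (q * t)).
Proof.
by move=> t0; rewrite /gamma_fun indicE mem_set ?mul1r//= in_itv/= t0.
Qed.

Lemma gamma_fun0 p q t : t <= 0 -> gamma_fun p q t = 0.
Proof.
move=> t0; rewrite /gamma_fun indicE memNset ?mul0r//=.
by rewrite in_itv/= andbT ltNge t0.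
Qed.

Lemma measurable_gamma_fun p q : measurable_fun setT (gamma_fun p q).
Proof.
apply: measurable_funM => //; apply: measurable_funM => //.
apply: measurableT_comp => //; apply: measurableT_comp => //.
Qed.

Lemma Gamma_ge0 p : 0 <= Gamma p :> R.
Proof.
apply/fine_ge0/integral_ge0 => t _.
by rewrite lee_fin mulr_ge0 ?powR_ge0 ?expR_ge0.
Qed.

Lemma integral_gamma_fun1 p : 0 < p ->
  (\int[mu]_t (gamma_fun p 1 t)%:E = (Gamma p)%:E)%E.
Proof.
move=> p0; rewrite /Gamma fineK; last first.
  rewrite ge0_fin_numE ?Gamma_integral_fin//; apply: integral_ge0 => t _.
  by rewrite lee_fin mulr_ge0 ?powR_ge0 ?expR_ge0.
rewrite [RHS]integral_mkcond; apply: eq_integral => t _.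
rewrite patchE; case: ifPn => [|].
  by rewrite inE/= in_itv/= andbT => t0; rewrite gamma_funE// mul1r.
by rewrite notin_setE/= in_itv/= andbT => /negP; rewrite -leNgt => /gamma_fun0 ->.
Qed.

Lemma Gamma_gt0 p : 0 < p -> 0 < Gamma p :> R.
Proof.
move=> p0; rewrite -lte_fin /Gamma fineK; last first.
  rewrite ge0_fin_numE ?Gamma_integral_fin//; apply: integral_ge0 => t _.
  by rewrite lee_fin mulr_ge0 ?powR_ge0 ?expR_ge0.
have m0 : (0 < mu `]0%R, +oo[%classic)%E.
  by rewrite lebesgue_measure_itv/= ltry addye// ltry.
apply: (ge0_integral_gt0 _ m0) => //.
- apply/measurable_EFinP/measurable_funTS/measurable_funM => //.
  by apply: measurableT_comp => //; exact: oppr_measurable.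
- move=> t; rewrite /= in_itv/= andbT => t0.
  by rewrite lte_fin mulr_gt0 ?expR_gt0 ?powR_gt0.
Qed.

Lemma integral_gamma_fun p q : 0 < p -> 0 < q ->
  (\int[mu]_t (gamma_fun p q t)%:E = (Gamma p * q `^ (- p))%:E)%E.
Proof.
move=> p0 q0; rewrite EFinM -integral_gamma_fun1//.
have mg r : measurable_fun setT (EFin \o gamma_fun p r).
  by apply/measurable_EFinP; exact: measurable_gamma_fun.
have g0 r t : (0 <= (EFin \o gamma_fun p r) t)%E.
  by rewrite lee_fin gamma_fun_ge0.
rewrite (@ge0_integral_affine R q 0 (EFin \o gamma_fun p 1))//.
have E t : gamma_fun p 1 (q * t + 0) = q `^ (p - 1) * gamma_fun p q t.
  rewrite addr0; have [t0|t0] := ltP 0 t.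
    rewrite !gamma_funE ?mulr_gt0// powRM ?(ltW q0) ?(ltW t0)// mul1r.
    by rewrite mulrA.
  by rewrite !gamma_fun0 ?mulr0// pmulr_rle0.
apply/esym; under eq_integral => t _ do rewrite /comp E EFinM.
rewrite ge0_integralZl_EFin ?powR_ge0//; last 2 first.
- by move=> t _; exact: (g0 q t).
- exact: mg.
rewrite muleAC muleA -!EFinM mulrAC mulr_powRB1 ?(ltW q0)//.
by rewrite powRN mulfV ?mul1e// powR_eq0 gt_eqF.
Qed.

(** Here [a] and [b] are the Gamma shapes a1 and a2, not the exponents of the prior. *)
Definition gamma_beta_fun a b p r (w : R * R) : R :=
  \1_(`]0%R, +oo[ `*` `]0%R, 1%R[) w *
  (w.1 `^ (a + b - 1) * w.2 `^ (a - 1) * (1 - w.2) `^ (b - 1) *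
   expR (- (w.1 * (p + w.2 * r)))).

Lemma gamma_beta_fun_ge0 a b p r w : 0 <= gamma_beta_fun a b p r w.
Proof. by rewrite /gamma_beta_fun !mulr_ge0 ?powR_ge0 ?expR_ge0. Qed.

Lemma measurable_gamma_beta_fun a b p r :
  measurable_fun setT (gamma_beta_fun a b p r).
Proof.
apply: measurable_funM.
  by apply: measurable_indic; exact: measurableX.
apply: measurable_funM; last first.
  apply: measurableT_comp => //; apply: measurableT_comp => //.
  apply: measurable_funM => //; apply: measurable_funD => //.
  exact: measurable_funM.
apply: measurable_funM.
  apply: measurable_funM.
    exact: (measurableT_comp (measurable_powR _)).
  exact: (measurableT_comp (measurable_powR _)).
apply: (measurableT_comp (measurable_powR _)).
exact: measurable_funB.
Qed.

(* The substitution x = eta * lambda turns the integrand into a convolution of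
   two gamma integrands. *)
Lemma gamma_beta_funE a b p r (eta x : R) : 0 < eta ->
  gamma_beta_fun a b p r (eta, eta^-1 * x) =
  eta * (gamma_fun a (p + r) x * gamma_fun b p (eta - x)).
Proof.
move=> eta0; rewrite /gamma_beta_fun indicE.
have [/andP[x0 xe]|xe] := boolP (0 < x < eta); last first.
  rewrite memNset; last first.
    move=> [_ /=]; rewrite in_itv/= => /andP[]; rewrite pmulr_rgt0 ?invr_gt0//.
    by rewrite mulrC ltr_pdivrMr// mul1r => x0 xe'; move: xe; rewrite x0 xe'.
  rewrite mul0r; have [x0|x0] := ltP 0 x; last by rewrite gamma_fun0// mul0r mulr0.
  move: xe; rewrite x0/= -leNgt => xe.
  by rewrite (@gamma_fun0 _ _ (_ - _)) ?subr_le0// !mulr0.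
rewrite mem_set ?mul1r; last first.
  split; rewrite /= in_itv/= ?eta0// pmulr_rgt0 ?invr_gt0// x0/=.
  by rewrite mulrC ltr_pdivrMr// mul1r.
rewrite !gamma_funE ?subr_gt0//=.
have -> : 1 - eta^-1 * x = eta^-1 * (eta - x) by field; rewrite gt_eqF.
rewrite !powRM ?invr_ge0 ?(ltW eta0) ?(ltW x0) ?subr_ge0 ?(ltW xe)//.
have -> : - (eta * (p + eta^-1 * x * r)) = - ((p + r) * x) + - (p * (eta - x)).
  by field; rewrite gt_eqF.
rewrite expRD.
have -> : eta `^ (a + b - 1) = eta * eta `^ (a - 1) * eta `^ (b - 1).
  rewrite -{2}(powRr1 (ltW eta0)) -!powRD; last 2 first.
  - by rewrite (gt_eqF eta0) implybT.
  - by rewrite (gt_eqF eta0) implybT.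
  by congr powR; ring.
have V c : eta^-1 `^ c = (eta `^ c)^-1.
  by rewrite -powR_inv1 ?(ltW eta0)// -powRrM mulN1r powRN.
rewrite !V; have := powR_gt0 (a - 1) eta0; have := powR_gt0 (b - 1) eta0.
by move=> e1 e2; field; rewrite !gt_eqF.
Qed.

Lemma integral_gamma_beta_fun a b p r : 0 < a -> 0 < b -> 0 < p -> 0 < p + r ->
  (\int[mu \x mu]_w (gamma_beta_fun a b p r w)%:E =
   (Gamma a * Gamma b * p `^ (- b) * (p + r) `^ (- a))%:E)%E.
Proof.
move=> a0 b0 p0 pr0.
have mh := @measurable_gamma_beta_fun a b p r.
rewrite (@fubini_tonelli1 _ _ (measurableTypeR R) (measurableTypeR R) R mu mu
  (EFin \o gamma_beta_fun a b p r)); last 2 first.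
- exact/measurable_EFinP.
- by move=> w; rewrite lee_fin gamma_beta_fun_ge0.
pose k (z : R * R) := gamma_fun a (p + r) z.2 * gamma_fun b p (z.1 - z.2).
have k0 z : 0 <= k z by rewrite mulr_ge0 ?gamma_fun_ge0.
have mk : measurable_fun setT (EFin \o k).
  apply/measurable_EFinP/measurable_funM.
    exact: (measurableT_comp (measurable_gamma_fun _ _)).
  apply: (measurableT_comp (measurable_gamma_fun _ _)).
  exact: measurable_funB.
transitivity (\int[mu]_eta \int[mu]_x (k (eta, x))%:E)%E.
  apply: eq_integral => eta _; rewrite /fubini_F.
  have [eta0|eta0] := ltP 0 eta; last first.
    rewrite integral0_eq; last first.
      move=> x _; rewrite /= /gamma_beta_fun indicE memNset ?mul0r//.
      by move=> [/=]; rewrite in_itv/= andbT ltNge eta0.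
    rewrite integral0_eq// => x _; rewrite /k/=.
    have [x0|x0] := ltP 0 x; last by rewrite gamma_fun0// mul0r.
    by rewrite (@gamma_fun0 _ _ (_ - _)) ?mulr0// subr_le0 (le_trans eta0)// ltW.
  (* Substituting lambda = x / eta: the Jacobian [eta^-1] cancels the factor [eta] of
     [gamma_beta_funE]. *)
  rewrite (@ge0_integral_affine R eta^-1 0
    (fun x => (gamma_beta_fun a b p r (eta, x))%:E)) ?invr_gt0//; last 2 first.
  - by apply/measurable_EFinP; exact: (measurableT_comp mh (pair1_measurable _)).
  - by move=> x; rewrite lee_fin gamma_beta_fun_ge0.
  under eq_integral => x _ do rewrite addr0 gamma_beta_funE// EFinM.
  rewrite ge0_integralZl_EFin ?(ltW eta0)//; last 2 first.
  - by move=> x _; rewrite lee_fin (k0 (eta, x)).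
  - exact: (measurableT_comp mk (pair1_measurable _)).
  by rewrite muleA -EFinM mulVf ?mul1e// gt_eqF.
rewrite (@fubini_tonelli _ _ (measurableTypeR R) (measurableTypeR R) R mu mu
  (EFin \o k))//.
transitivity (\int[mu]_x
    ((Gamma b * p `^ (- b))%:E * (gamma_fun a (p + r) x)%:E))%E.
  apply: eq_integral => x _ /=; rewrite /k/=.
  under eq_integral => eta _ do rewrite EFinM.
  rewrite ge0_integralZl_EFin ?gamma_fun_ge0//; last 2 first.
  - by move=> eta _; rewrite lee_fin gamma_fun_ge0.
  - apply/measurable_EFinP; apply: (measurableT_comp (measurable_gamma_fun _ _)).
    exact: measurable_funB.
  (* After the exchange, translating eta by x decouples the two Gamma integrands. *)
  rewrite (@ge0_integral_affine R 1 x
    (fun eta => (gamma_fun b p (eta - x))%:E))//; last 2 first.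
  - apply/measurable_EFinP; apply: (measurableT_comp (measurable_gamma_fun _ _)).
    exact: measurable_funB.
  - by move=> eta; rewrite lee_fin gamma_fun_ge0.
  under eq_integral => eta _ do rewrite mul1r addrK.
  by rewrite integral_gamma_fun// mul1e muleC.
rewrite ge0_integralZl_EFin//; last 3 first.
- by move=> x _; rewrite lee_fin gamma_fun_ge0.
- by apply/measurable_EFinP; exact: measurable_gamma_fun.
- by rewrite mulr_ge0 ?Gamma_ge0 ?powR_ge0.
by rewrite integral_gamma_fun// -EFinM; congr EFin; ring.
Qed.

End gamma_beta.

Section gaussian.
Context {R : realType}.
Local Notation mu := (@lebesgue_measure R).

(** The integrand is a multiple of the normal density with mean h and variance 1/p, which has total
    mass 1. *)
Lemma gaussian_integral (p h : R) : 0 < p ->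
  (\int[mu]_t (expR (- (p / 2 * (t - h) ^+ 2)))%:E =
   (Num.sqrt (2 * pi / p))%:E)%E.
Proof.
move=> p0; pose s := Num.sqrt p^-1.
have s0 : 0 < s by rewrite sqrtr_gt0 invr_gt0.
have sE : s ^+ 2 = p^-1 by rewrite sqr_sqrtr// invr_ge0 ltW.
have n0 := @normal_peak_gt0 R s (lt0r_neq0 s0).
have E t : expR (- (p / 2 * (t - h) ^+ 2)) =
    (normal_peak s)^-1 * normal_pdf h s t.
  rewrite normal_pdfE ?gt_eqF// mulKf ?gt_eqF// /normal_fun sE.
  by congr expR; field; rewrite gt_eqF.
under eq_integral => t _ do rewrite E EFinM.
rewrite ge0_integralZl_EFin//; last 3 first.
- by move=> t _; rewrite lee_fin normal_pdf_ge0.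
- by apply/measurable_EFinP; exact: measurable_normal_pdf.
- by rewrite invr_ge0 ltW.
rewrite integral_normal_pdf mule1 /normal_peak invrK sE.
by congr (Num.sqrt _)%:E; rewrite -mulr_natr; ring.
Qed.

End gaussian.

(** * Integrating out one parameter *)

Section coordinate.
Context {R : realType}.
Local Notation mu := (@lebesgue_measure R).
Variables v d kap c q z : R.
Hypotheses (d0 : 0 < d) (kap0 : 0 < kap) (c1 : 1 <= c) (q0 : 0 <= q).

(* Inverses are written with [powR], which agrees with [^-1] on positive
   arguments and is measurable on the whole line. *)
Definition shrink_prec (lam : R) : R := kap * (lam * (c - lam) `^ (-1)).

(** One parameter coordinate t: the N(t, d/eta) density at v, times the centered prior density of
    precision eta * [shrink_prec] at t, times the factor exp(-q eta (z-t)^2 / 2) left by the q-th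
    power of the future density. See [coord_fun_normal]. *)
Definition coord_fun (t : R) (w : R * R) : R :=
  w.1 / (2 * pi) * (shrink_prec w.2 / d) `^ 2^-1 *
  expR (- (w.1 / 2 * ((v - t) ^+ 2 / d + shrink_prec w.2 * t ^+ 2 +
                      q * (z - t) ^+ 2))).

Definition coord_prec (lam : R) : R := d^-1 + shrink_prec lam + q.

Definition coord_value (w : R * R) : R :=
  (w.1 / (2 * pi)) `^ 2^-1 *
  (shrink_prec w.2 / d * coord_prec w.2 `^ (-1)) `^ 2^-1 *
  expR (- (w.1 / 2 * (v ^+ 2 / d + q * z ^+ 2 -
                      (v / d + q * z) ^+ 2 * coord_prec w.2 `^ (-1)))).

Lemma shrink_prec_gt0 lam : 0 < lam < 1 -> 0 < shrink_prec lam.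
Proof.
move=> /andP[l0 l1]; rewrite /shrink_prec !mulr_gt0// powR_gt0// subr_gt0.
exact: lt_le_trans l1 c1.
Qed.

Lemma coord_prec_gt0 lam : 0 < lam < 1 -> 0 < coord_prec lam.
Proof.
move=> /shrink_prec_gt0 t0; rewrite /coord_prec.
by rewrite ltr_pwDl// addr_gt0// invr_gt0.
Qed.

Lemma measurable_shrink_prec : measurable_fun setT shrink_prec.
Proof.
apply: measurable_funM => //; apply: measurable_funM => //.
apply: (measurableT_comp (measurable_powR _)).
exact: measurable_funB.
Qed.

Lemma measurable_coord_fun :
  measurable_fun setT (fun p : R * (R * R) => coord_fun p.1 p.2).
Proof.
have mtau : measurable_fun setT (fun p : R * (R * R) => shrink_prec p.2.2).
  apply: (measurableT_comp measurable_shrink_prec).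
  by apply: measurableT_comp.
have meta : measurable_fun setT (fun p : R * (R * R) => p.2.1).
  by apply: measurableT_comp.
rewrite /coord_fun; apply: measurable_funM.
  apply: measurable_funM.
    by apply: measurable_funM.
  apply: (measurableT_comp (measurable_powR _)).
  exact: measurable_funM.
apply: measurableT_comp => //; apply: measurableT_comp => //.
apply: measurable_funM; first exact: measurable_funM.
apply: measurable_funD; first apply: measurable_funD.
- apply: measurable_funM => //; apply: measurable_funX.
  exact: measurable_funB.
- by apply: measurable_funM => //; exact: measurable_funX.
- apply: measurable_funM => //; apply: measurable_funX.
  exact: measurable_funB.
Qed.

Lemma measurable_coord_value : measurable_fun setT coord_value.
Proof.
have mtau : measurable_fun setT (fun p : R * R => shrink_prec p.2).
  exact: (measurableT_comp measurable_shrink_prec).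
have mprec : measurable_fun setT (fun p : R * R => coord_prec p.2 `^ (-1)).
  apply: (measurableT_comp (measurable_powR _)).
  by apply: measurable_funD => //; exact: measurable_funD.
rewrite /coord_value; apply: measurable_funM.
  apply: measurable_funM.
    apply: (measurableT_comp (measurable_powR _)).
    by apply: measurable_funM.
  apply: (measurableT_comp (measurable_powR _)).
  by apply: measurable_funM => //; exact: measurable_funM.
apply: measurableT_comp => //; apply: measurableT_comp => //.
apply: measurable_funM; first exact: measurable_funM.
by apply: measurable_funB => //; exact: measurable_funM.
Qed.

Lemma coord_fun_ge0 t w : 0 < w.1 -> 0 <= coord_fun t w.
Proof.
move=> w0; rewrite /coord_fun !mulr_ge0 ?powR_ge0 ?expR_ge0 ?(ltW w0)//.
by rewrite invr_ge0 mulr_ge0// pi_ge0.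
Qed.

Lemma coord_value_gt0 w : 0 < w.1 -> 0 < w.2 < 1 -> 0 < coord_value w.
Proof.
move=> w0 w1; have t0 := shrink_prec_gt0 w1; have S0 := coord_prec_gt0 w1.
rewrite /coord_value mulr_gt0 ?expR_gt0// mulr_gt0 ?powR_gt0//.
  by rewrite divr_gt0// mulr_gt0// pi_gt0.
by rewrite mulr_gt0 ?divr_gt0// powR_gt0.
Qed.

Lemma integral_coord_fun w : 0 < w.1 -> 0 < w.2 < 1 ->
  (\int[mu]_t (coord_fun t w)%:E = (coord_value w)%:E)%E.
Proof.
case: w => eta lam /= eta0 lam01; rewrite /coord_fun /coord_value/=.
have t0 := shrink_prec_gt0 lam01; have S0 := coord_prec_gt0 lam01.
set tau := shrink_prec lam in t0 *; set S := coord_prec lam in S0 *.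
have SE : S = d^-1 + tau + q by [].
rewrite powR_inv1 ?(ltW S0)//.
(* [h] is the conditional mean of t, where the quadratic form of the exponent attains its minimum
   [M]. *)
pose h := (v / d + q * z) / S.
have pi0 : 0 < pi :> R by exact: pi_gt0.
have Sn0 : d^-1 + tau + q != 0 by rewrite -SE gt_eqF.
pose M := v ^+ 2 / d + q * z ^+ 2 - (v / d + q * z) ^+ 2 / S.
have E t : expR (- (eta / 2 * ((v - t) ^+ 2 / d + tau * t ^+ 2 +
     q * (z - t) ^+ 2))) =
   expR (- (eta / 2 * M)) * expR (- (eta * S / 2 * (t - h) ^+ 2)).
  rewrite -expRD; congr expR; rewrite /M /h SE; field.
  by rewrite (gt_eqF d0)/= gt_eqF// -addrA ltr_pwDl// addr_ge0// mulr_ge0// ltW.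
under eq_integral => t _ do rewrite E mulrA EFinM.
rewrite ge0_integralZl_EFin//; last 2 first.
- apply/measurable_EFinP; apply: measurableT_comp => //.
  apply: measurableT_comp => //; apply: measurable_funM => //.
  by apply: measurable_funX; exact: measurable_funB.
- by rewrite !mulr_ge0 ?expR_ge0 ?powR_ge0 ?(ltW eta0)// invr_ge0 mulr_ge0// ltW.
rewrite gaussian_integral ?mulr_gt0// -EFinM; congr EFin.
rewrite mulrAC; congr (_ * _).
rewrite -powR12_sqrt; last by rewrite divr_ge0 ?mulr_ge0// ltW// mulr_gt0.
have e0 : 0 < eta / (2 * pi) by rewrite divr_gt0// mulr_gt0.
(* One of the two square roots of eta / (2 pi) cancels against the Gaussian constant; the other one
   remains in [coord_value]. *)
have -> : eta / (2 * pi) * (tau / d) `^ 2^-1 =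
    (eta / (2 * pi)) `^ 2^-1 * (eta / (2 * pi)) `^ 2^-1 * (tau / d) `^ 2^-1.
  rewrite -powRD; last by rewrite (gt_eqF e0) implybT.
  by rewrite (_ : 2^-1 + 2^-1 = 1) ?powRr1 ?(ltW e0)//; field.
have a1 : 0 <= eta / (2 * pi) by exact: ltW.
have a2 : 0 <= tau / d by rewrite divr_ge0// ltW.
have a3 : 0 <= 2 * pi / (eta * S) by rewrite divr_ge0 ?mulr_ge0// ltW// mulr_gt0.
have E2 : eta / (2 * pi) * (tau / d) * (2 * pi / (eta * S)) = tau / d / S.
  by move: (pi) pi0 => P P0; field; rewrite !gt_eqF.
have a4 : 0 <= tau / d / S by rewrite divr_ge0// ltW.
rewrite -(mulrA (_ `^ _)) -(mulrA (_ `^ _)) -!powRM ?E2//; exact: mulr_ge0.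
Qed.

End coordinate.

Section coordinate_value.
Context {R : realType}.
Variables v d c : R.
Hypotheses (d0 : 0 < d) (c1 : 1 <= c).

(** With kap = 1/d + q the total precision is kap c / (c - lambda). Hence prior over total precision
    is lambda / c, which yields the square root of lambda, and the subtracted square in the exponent
    is affine in lambda. *)
Lemma coord_valueE q z w : 0 <= q -> 0 < w.1 -> 0 < w.2 < 1 ->
  coord_value v d (d^-1 + q) c q z w =
  (2 * pi * (c * d)) `^ (- 2^-1) * (w.1 `^ 2^-1 * w.2 `^ 2^-1) *
  expR (- (w.1 * ((q * (v - z) ^+ 2 / (1 + q * d)) / 2 +
     w.2 * ((v + q * d * z) ^+ 2 / (c * d * (1 + q * d)) / 2)))).
Proof.
case: w => eta lam /= q0 eta0 /andP[l0 l1]; rewrite /coord_value/=.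
have cl : 0 < c - lam by rewrite subr_gt0 (lt_le_trans l1).
have c0 : 0 < c by apply: lt_le_trans c1.
have pi0 : 0 < pi :> R by exact: pi_gt0.
have qd0 : 0 < 1 + q * d by rewrite ltr_pwDl// mulr_ge0// ltW.
have SE : coord_prec d (d^-1 + q) c q lam = (d^-1 + q) * (c / (c - lam)).
  rewrite /coord_prec /shrink_prec powR_inv1 ?(ltW cl)//.
  by field; rewrite !gt_eqF.
have S0 : 0 < (d^-1 + q) * (c / (c - lam)).
  by rewrite mulr_gt0 ?divr_gt0// ltr_pwDl// invr_gt0.
rewrite SE powR_inv1 ?(ltW S0)// /shrink_prec powR_inv1 ?(ltW cl)//.
congr (_ * expR _); last first.
  by field; rewrite !gt_eqF.
have E : (d^-1 + q) * (lam / (c - lam)) / d / ((d^-1 + q) * (c / (c - lam))) =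
    lam / (c * d).
  by field; rewrite !gt_eqF.
have cd0 : 0 < 2 * pi * (c * d) by rewrite !mulr_gt0.
have -> : (2 * pi * (c * d)) `^ (- 2^-1) = (2 * pi * (c * d))^-1 `^ 2^-1.
  by rewrite -[in RHS](powR_inv1 (ltW cd0)) -powRrM mulN1r.
rewrite E -!powRM ?invr_ge0 ?mulr_ge0 ?divr_ge0 ?pi_ge0 ?mulr_ge0 ?(ltW l0) ?(ltW eta0)
  ?(ltW c0) ?(ltW d0)//.
congr (fun x => x `^ 2^-1).
- by move: (pi) pi0 => P P0; field; rewrite !gt_eqF.
- by rewrite invr_ge0 mulr_ge0// ltW.
- by rewrite invr_ge0 mulr_ge0// ltW.
Qed.

(** Serves the evidence: the future observation is gone, but the prior still contains 1/d + q, so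
    the precisions no longer combine into a closed form of the same kind. The exponential is bounded
    by 1 and only the power of lambda is kept. *)
Lemma coord_value0_le q w : 0 <= q -> 0 < w.1 -> 0 < w.2 < 1 ->
  coord_value v d (d^-1 + q) c 0 0 w <=
  (2 * pi) `^ (- 2^-1) * (d^-1 + q) `^ 2^-1 * (w.1 `^ 2^-1 * w.2 `^ 2^-1).
Proof.
case: w => eta lam /= q0 eta0 /andP[l0 l1]; rewrite /coord_value/=.
have cl : 0 < c - lam by rewrite subr_gt0 (lt_le_trans l1).
have pi0 : 0 < pi :> R by exact: pi_gt0.
have di0 : 0 < d^-1 by rewrite invr_gt0.
have k0 : 0 < d^-1 + q by rewrite ltr_pwDl.
have t0 : 0 < shrink_prec (d^-1 + q) c lam.
  by rewrite /shrink_prec powR_inv1 ?(ltW cl)// mulr_gt0// divr_gt0.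
have SE : coord_prec d (d^-1 + q) c 0 lam = d^-1 + shrink_prec (d^-1 + q) c lam.
  by rewrite /coord_prec addr0.
have S0 : 0 < d^-1 + shrink_prec (d^-1 + q) c lam by rewrite addr_gt0.
rewrite SE powR_inv1 ?(ltW S0)//.
set tau := shrink_prec _ _ _ in t0 S0 *.
have tE : tau = (d^-1 + q) * lam / (c - lam).
  by rewrite /tau /shrink_prec powR_inv1 ?(ltW cl)// mulrA.
have e1 : expR (- (eta / 2 * (v ^+ 2 / d + 0 * 0 ^+ 2 -
    (v / d + 0 * 0) ^+ 2 / (d^-1 + tau)))) <= 1.
  rewrite -[leRHS]expR0 ler_expR oppr_le0 mulr_ge0 ?divr_ge0 ?(ltW eta0)//.
  rewrite !mul0r !addr0.
  have -> : v ^+ 2 / d - (v / d) ^+ 2 / (d^-1 + tau) =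
            v ^+ 2 / d * (tau / (d^-1 + tau)).
    by field; rewrite !gt_eqF//= ltr_pwDl// mulr_ge0// ltW.
  by rewrite mulr_ge0 ?divr_ge0 ?sqr_ge0// ltW.
have p1 : (eta / (2 * pi)) `^ 2^-1 = (2 * pi) `^ (- 2^-1) * eta `^ 2^-1.
  have p0 : 0 < 2 * pi :> R by rewrite mulr_gt0.
  rewrite [LHS]powRM; [|exact: ltW|by rewrite invr_ge0 ltW].
  rewrite mulrC; congr (_ * _).
  by rewrite -[in LHS](powR_inv1 (ltW p0)) -powRrM mulN1r.
(* The left base equals (1/d + q) lam / (c + q d lam), whose denominator is at least 1. *)
have p2 : (tau / d / (d^-1 + tau)) `^ 2^-1 <= (d^-1 + q) `^ 2^-1 * lam `^ 2^-1.
  rewrite -powRM ?(ltW k0) ?(ltW l0)//.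
  have A : 0 <= tau / d / (d^-1 + tau) by rewrite !divr_ge0// ltW.
  have B : 0 <= (d^-1 + q) * lam by rewrite mulr_ge0// ltW.
  apply: ge0_ler_powR; rewrite ?nnegrE ?invr_ge0//.
  rewrite ler_pdivrMr// tE.
  have D : 0 < d * (c - lam) by rewrite mulr_gt0.
  have c0 : 0 <= c - 1 by rewrite subr_ge0.
  rewrite -subr_ge0.
  have -> : (d^-1 + q) * lam * (d^-1 + (d^-1 + q) * lam / (c - lam)) -
     (d^-1 + q) * lam / (c - lam) / d =
     (d^-1 + q) * lam * (c - 1 + q * d * lam) / (d * (c - lam)).
    by field; rewrite !gt_eqF.
  apply: divr_ge0; last exact: ltW.
  by apply: mulr_ge0 => //; apply: addr_ge0 => //; rewrite !mulr_ge0// ltW.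
rewrite p1 [leRHS](_ : _ = (2 * pi) `^ (- 2^-1) * eta `^ 2^-1 *
  ((d^-1 + q) `^ 2^-1 * lam `^ 2^-1 * 1)); last by ring.
rewrite -[leLHS]mulrA ler_wpM2l ?mulr_ge0 ?powR_ge0//.
by apply: ler_pM; rewrite ?powR_ge0 ?expR_ge0.
Qed.

End coordinate_value.

(** * Diagonal covariance matrices *)

Section diagonal_forms.
Context {R : realType}.

Lemma qform_diag n (e : 'rV[R]_n) (x : 'cV[R]_n) :
  qform (diag_mx e) x = \sum_i e ord0 i * x i ord0 ^+ 2.
Proof.
rewrite /qform mul_mx_diag mxE; apply: eq_bigr => i _.
by rewrite !mxE mulrAC mulrC expr2.
Qed.

Lemma qformB n (A B : 'M[R]_n) (x : 'cV[R]_n) :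
  qform (A - B) x = qform A x - qform B x.
Proof. by rewrite /qform mulmxBr mulmxBl !mxE. Qed.

Lemma qform_scalar n (a : R) (x : 'cV[R]_n) :
  qform a%:M x = a * \sum_i x i ord0 ^+ 2.
Proof.
rewrite -diag_const_mx qform_diag mulr_sumr.
by apply: eq_bigr => i _; rewrite mxE.
Qed.

Lemma invmx_eq n (A B : 'M[R]_n) : A *m B = 1%:M -> invmx A = B.
Proof.
move=> AB; have [uA _] := mulmx1_unit AB.
by rewrite -[LHS]mulmx1 -AB mulmxA mulVmx// mul1mx.
Qed.

Lemma diag_mxM n (e f : 'rV[R]_n) :
  diag_mx e *m diag_mx f = diag_mx (\row_i (e ord0 i * f ord0 i)).
Proof.
apply/matrixP => i j; rewrite mul_diag_mx !mxE.
by case: eqP => [->|]; rewrite ?mulr1n ?mulr0n ?mulr0.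
Qed.

Lemma diag_mxV n (e : 'rV[R]_n) : (forall i, e ord0 i != 0) ->
  invmx (diag_mx e) = diag_mx (\row_i (e ord0 i)^-1).
Proof.
move=> e0; apply: invmx_eq; rewrite diag_mxM -diag_const_mx; congr diag_mx.
by apply/rowP => i; rewrite !mxE mulfV.
Qed.

Lemma scale_diag_mx n (a : R) (e : 'rV[R]_n) :
  a *: diag_mx e = diag_mx (\row_i (a * e ord0 i)).
Proof. by apply/matrixP => i j; rewrite !mxE mulrnAr. Qed.

Lemma diag_mxD n (e f : 'rV[R]_n) :
  diag_mx e + diag_mx f = diag_mx (\row_i (e ord0 i + f ord0 i)).
Proof. by apply/matrixP => i j; rewrite !mxE mulrnDl. Qed.

Lemma scalar_diag_mx n (a : R) : a%:M = diag_mx (\row_(i < n) a).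
Proof.
by rewrite -diag_const_mx; congr diag_mx; apply/rowP => i; rewrite !mxE.
Qed.

Lemma diag_mxB n (e f : 'rV[R]_n) :
  diag_mx e - diag_mx f = diag_mx (\row_i (e ord0 i - f ord0 i)).
Proof. by apply/matrixP => i j; rewrite !mxE mulrnBl. Qed.

Definition normal_density1 (mean var x : R) : R :=
  (2 * pi) `^ (- 2^-1) * var `^ (- 2^-1) *
  expR (- ((x - mean) ^+ 2 / var / 2)).

Lemma normal_density_diag n (mean x : 'cV[R]_n) (e : 'rV[R]_n) :
  (forall i, 0 < e ord0 i) ->
  normal_density mean (diag_mx e) x =
  \prod_i normal_density1 (mean i ord0) (e ord0 i) (x i ord0).
Proof.
move=> e0; rewrite /normal_density /normal_density1 !big_split/=.
congr (_ * _ * _).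
- rewrite prodr_const card_ord -powR_mulrn ?powR_ge0// -powRrM.
  by congr powR; ring.
- rewrite det_diag.
  (* Nonnegativity is carried through the induction because [powRM] requires it of each partial
     product. *)
  suff [] : 0 <= \prod_i e ord0 i /\ (\prod_i e ord0 i) `^ (- (1 / 2)) =
      \prod_i e ord0 i `^ (- 2^-1) by [].
  elim/big_ind2 : _ => [|x1 x2 y1 y2 [p1 <-] [p2 <-]|i _].
  - by rewrite powR1.
  - by rewrite mulr_ge0// powRM.
  - by rewrite mul1r ltW.
- rewrite -expR_sum diag_mxV => [|i]; last by rewrite gt_eqF.
  rewrite qform_diag; congr expR; rewrite mulr_sumr; apply: eq_bigr => i _.
  by rewrite !mxE; field; rewrite gt_eqF.
Qed.

(** Pythagoras: Q Q'y is the orthogonal projection of y on the range of Q, and Q is an isometry. *)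
Lemma sum_sqr_split m l (Q : 'M[R]_(m, l)) (y : 'cV[R]_m) (u : 'cV[R]_l) :
  Q^T *m Q = 1%:M ->
  \sum_i (y - Q *m u) i ord0 ^+ 2 =
  \sum_i (y - Q *m (Q^T *m y)) i ord0 ^+ 2 +
  \sum_i ((Q^T *m y) i ord0 - u i ord0) ^+ 2.
Proof.
move=> QQ.
have S n (x : 'cV[R]_n) : \sum_i x i ord0 ^+ 2 = (x^T *m x) ord0 ord0.
  by rewrite mxE; apply: eq_bigr => i _; rewrite mxE expr2.
have -> : \sum_i ((Q^T *m y) i ord0 - u i ord0) ^+ 2 =
    \sum_i (Q^T *m y - u) i ord0 ^+ 2.
  by apply: eq_bigr => i _; rewrite !mxE.
rewrite !S.
set z := Q^T *m y; set r := y - Q *m z; set h := z - u.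
have -> : y - Q *m u = r + Q *m h.
  by rewrite /r /h mulmxBr addrA subrK.
have rQ : Q^T *m r = 0 by rewrite mulmxBr mulmxA QQ mul1mx subrr.
have rQ' : r^T *m Q = 0 by rewrite -[LHS]trmxK trmx_mul trmxK rQ trmx0.
clearbody r h; have -> : (r + Q *m h)^T = r^T + h^T *m Q^T by rewrite -trmx_mul -raddfD.
rewrite mulmxDl !mulmxDr (mulmxA r^T) rQ' mul0mx addr0.
rewrite -(mulmxA _ Q^T r) rQ mulmx0 add0r.
by rewrite -(mulmxA _ Q^T) (mulmxA Q^T) QQ mul1mx mxE.
Qed.

(** The matrix acts as b on the orthogonal complement of the range of Q and as b + e_i along its
    i-th column, so its inverse acts by the reciprocals. *)
Lemma qform_range m l (Q : 'M[R]_(m, l)) (b : R) (e : 'rV[R]_l)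
    (y : 'cV[R]_m) (u : 'cV[R]_l) :
  Q^T *m Q = 1%:M -> 0 < b -> (forall i, 0 <= e ord0 i) ->
  qform (invmx (b%:M + Q *m diag_mx e *m Q^T)) (y - Q *m u) =
  (\sum_i (y - Q *m (Q^T *m y)) i ord0 ^+ 2) / b +
  \sum_i ((Q^T *m y) i ord0 - u i ord0) ^+ 2 / (b + e ord0 i).
Proof.
move=> QQ b0 e0.
have be0 i : b + e ord0 i != 0 by rewrite gt_eqF// ltr_pwDl.
(* Chosen so that 1/b - f_i = 1/(b + e_i), as in the Woodbury formula. *)
pose f : 'rV[R]_l := \row_i (e ord0 i / (b * (b + e ord0 i))).
have -> : invmx (b%:M + Q *m diag_mx e *m Q^T) =
    b^-1%:M - Q *m diag_mx f *m Q^T.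
  apply: invmx_eq; rewrite mulmxDl !mulmxBr -scalar_mxM mulfV ?gt_eqF//.
  rewrite mul_scalar_mx mul_mx_scalar.
  have -> : Q *m diag_mx e *m Q^T *m (Q *m diag_mx f *m Q^T) =
      Q *m (diag_mx e *m diag_mx f) *m Q^T.
    by rewrite !mulmxA -(mulmxA _ Q^T Q) QQ mulmx1.
  have -> : b^-1 *: (Q *m diag_mx e *m Q^T) = b *: (Q *m diag_mx f *m Q^T) +
      Q *m (diag_mx e *m diag_mx f) *m Q^T.
    rewrite !(scalemxAl _ (Q *m _)) !(scalemxAr _ Q) -mulmxDl -mulmxDr.
    rewrite diag_mxM !scale_diag_mx diag_mxD.
    congr (_ *m diag_mx _ *m _); apply/rowP => i; rewrite !mxE.
    by field; rewrite be0 gt_eqF.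
  by rewrite addrK subrK.
set x := y - Q *m u.
have -> : qform (b^-1%:M - Q *m diag_mx f *m Q^T) x =
    qform b^-1%:M x - qform (diag_mx f) (Q^T *m x).
  by rewrite qformB; congr (_ - _); rewrite /qform trmx_mul trmxK !mulmxA.
rewrite qform_scalar qform_diag {1}/x (sum_sqr_split y u QQ) mulrDr (mulrC b^-1).
rewrite -[LHS]addrA; congr (_ + _).
rewrite mulr_sumr -sumrB; apply: eq_bigr => i _. 
have -> : (Q^T *m x) i ord0 = (Q^T *m y) i ord0 - u i ord0.
  by rewrite mulmxBr mulmxA QQ mul1mx !mxE.
by rewrite [f _ _]mxE; field; rewrite be0 gt_eqF.
Qed.

End diagonal_forms.

(** * Densities in terms of coordinate functions *)

Section factorization.
Context {R : realType}.
Implicit Types (eta lam q : R).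

Lemma powR_half_mul (x y : R) : 0 < x -> 0 < y ->
  x `^ (- 2^-1) * y `^ (- 2^-1) = ((x * y)^-1) `^ 2^-1.
Proof.
move=> x0 y0; rewrite -powRM ?ltW// -[in RHS](powR_inv1 (ltW (mulr_gt0 x0 y0))).
by rewrite -powRrM mulN1r.
Qed.

(** The prior variance kap^-1 (c/lam - 1) is the reciprocal of [shrink_prec], so the two normalizing
    constants merge into eta / (2 pi) times a square root. *)
Lemma coord_fun_normal (v d kap c q z t eta lam : R) :
  0 < d -> 0 < kap -> 1 <= c -> 0 < eta -> 0 < lam < 1 ->
  normal_density1 t (eta^-1 * d) v *
  normal_density1 0 (eta^-1 * (kap^-1 * (lam^-1 * c - 1))) t *
  expR (- (q * (eta / 2 * (z - t) ^+ 2))) = coord_fun v d kap c q z t (eta, lam).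
Proof.
move=> d0 k0 c1 e0 /andP[l0 l1].
have cl : 0 < c - lam by rewrite subr_gt0 (lt_le_trans l1).
have pi0 : 0 < pi :> R by exact: pi_gt0.
rewrite /normal_density1 /coord_fun /shrink_prec/= powR_inv1 ?(ltW cl)//.
have -> : lam^-1 * c - 1 = (c - lam) / lam by field; rewrite gt_eqF.
set s1 := eta^-1 * d; set s2 := eta^-1 * _.
have s10 : 0 < s1 by rewrite mulr_gt0 ?invr_gt0.
have s20 : 0 < s2 by rewrite mulr_gt0 ?invr_gt0// mulr_gt0 ?invr_gt0// divr_gt0.
have reorder (x y u p1 p2 p3 : R) : x * p1 * y * (x * p2 * u) * p3 =
   (x * x) * (p1 * p2) * (y * u * p3) by ring.
have p20 : 0 < 2 * pi :> R by rewrite mulr_gt0.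
rewrite reorder (powR_half_mul p20 p20) (powR_half_mul s10 s20).
have X0 : 0 < kap * (lam / (c - lam)) / d.
  by rewrite divr_gt0// mulr_gt0// divr_gt0.
have -> : (s1 * s2)^-1 = eta ^+ 2 * (kap * (lam / (c - lam)) / d).
  by rewrite /s1 /s2; field; rewrite !gt_eqF.
rewrite (powRM _ (sqr_ge0 eta) (ltW X0)).
have sq (x : R) : 0 < x -> (x ^+ 2) `^ 2^-1 = x.
  by move=> x0; rewrite powR12_sqrt ?sqr_ge0// sqrtr_sqr gtr0_norm.
rewrite sq// -expr2 -exprVn sq ?invr_gt0//.
rewrite -!expRD mulrA (mulrC _ eta); congr (_ * expR _).
by rewrite /s1 /s2; field; rewrite !gt_eqF.
Qed.

Lemma normal_density_iso m (mean x : 'cV[R]_m) eta : 0 < eta ->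
  normal_density mean (eta^-1 *: 1%:M) x =
  (2 * pi) `^ (- (m%:R / 2)) * eta `^ (m%:R / 2) *
  expR (- (eta / 2 * \sum_i (x - mean) i ord0 ^+ 2)).
Proof.
move=> e0; rewrite /normal_density scalemx1 det_scalar.
congr (_ * _ * expR _).
  rewrite -powR_mulrn ?invr_ge0 ?(ltW e0)// -powR_inv1 ?(ltW e0)//.
  by rewrite -!powRrM; congr powR; field.
rewrite (_ : invmx _ = eta%:M); last first.
  by apply: invmx_eq; rewrite -scalar_mxM mulVf// gt_eqF.
by rewrite qform_scalar; field.
Qed.

Lemma density_sE (n k : nat) eta (s : R) : (k < n)%N -> 0 < eta -> 0 < s ->
  density_s n k eta s =
  s `^ ((n - k)%:R / 2 - 1) / (2 `^ ((n - k)%:R / 2) * Gamma ((n - k)%:R / 2)) *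
  (eta `^ ((n - k)%:R / 2) * expR (- (eta / 2 * s))).
Proof.
move=> kn e0 s0; rewrite /density_s /chi2_density mulr_gt0//.
have N0 : 0 < (n - k)%:R / 2 :> R by rewrite divr_gt0// ltr0n subn_gt0.
rewrite powRM ?(ltW e0) ?(ltW s0)//.
rewrite -(mulr_powRB1 (ltW e0) N0).
rewrite (_ : eta * s / 2 = eta / 2 * s); last by ring.
by ring.
Qed.

End factorization.

(** * Integrating out the parameters *)

Section hierarchical.
Context {R : realType}.
Variables (n k m l : nat).
Variables (d : 'rV[R]_l) (Q : 'M[R]_(m, l)) (alpha a : R) (c : 'rV[R]_l) (gamma : R).
Variables (v : 'cV[R]_l) (vstar : 'cV[R]_(k - l)) (s : R) (y : 'cV[R]_m).
Hypotheses (kn : (k < n)%N) (d0 : forall i, 0 < d ord0 i) (QQ : Q^T *m Q = 1%:M).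
Hypotheses (alpha1 : alpha < 1) (c1 : forall i, 1 <= c ord0 i).
Hypotheses (gamma1 : 1 <= gamma) (s0 : 0 < s).

Local Notation beta := ((1 - alpha) / 2).
Local Notation N := ((n - k)%:R / 2 : R).
Local Notation z := (Q^T *m y).
Local Notation E := (`]0%R, +oo[%classic `*` `]0%R, 1%R[%classic : set (R * R)).
Local Notation mu := (@lebesgue_measure R).

(** Squared distance from y to the range of Q: the part of the exponent of the future density that
    theta cannot affect. *)
Definition residual : R := \sum_i (y - Q *m z) i ord0 ^+ 2.

(** Constants of the future density to the power q and of the chi-square density; those of the other
    normal densities stay inside [coord_fun]. *)
Definition base_const (q : R) : R :=
  (2 * pi) `^ (- (m%:R / 2) * q) *
  (s `^ (N - 1) / (2 `^ N * Gamma N)).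

(* The powers q = beta and q = 0 of the density of the future observation give
   the predictive kernel and the evidence. *)
Definition base_fun (q : R) (w : R * R) : R :=
  \1_E w * (base_const q *
    (w.1 `^ (m%:R / 2 * q) * w.1 `^ N * w.1 `^ a *
     (w.2 `^ a * (1 - w.2) `^ prior_b n k m alpha)) *
    expR (- (w.1 / 2 * (s + q * residual)))).

Definition theta_fun (q : R) (i : 'I_l) : R -> R * R -> R :=
  coord_fun (v i ord0) (d ord0 i) ((d ord0 i)^-1 + beta) (c ord0 i) q
    (z i ord0).

(** A coordinate of mu is the case of unit variance and kap = 1 with [gamma] for c; q = 0 because
    the future observation does not depend on mu, so the value z = 0 is arbitrary. *)
Definition mu_fun (j : 'I_(k - l)) : R -> R * R -> R :=
  coord_fun (vstar j ord0) 1 1 gamma 0 0.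

Lemma beta_gt0 : 0 < beta.
Proof. by rewrite divr_gt0// subr_gt0. Qed.

Lemma prior_theta_prec_gt0 i : 0 < (d ord0 i)^-1 + beta.
Proof. by rewrite addr_gt0 ?beta_gt0// invr_gt0. Qed.

Lemma dimension_gt0 : 0 < N.
Proof. by rewrite divr_gt0// ltr0n subn_gt0. Qed.

Lemma base_const_gt0 q : 0 < base_const q.
Proof.
have N0 := dimension_gt0.
have p0 : 0 < 2 * pi :> R by rewrite mulr_gt0// pi_gt0.
rewrite mulr_gt0 ?(powR_gt0 _ p0)// divr_gt0 ?(powR_gt0 _ s0)//.
by rewrite mulr_gt0 ?(powR_gt0 _ (@ltr0Sn R 1))// Gamma_gt0.
Qed.

Lemma base_funE q eta lam : 0 < eta -> 0 < lam < 1 ->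
  base_fun q (eta, lam) = base_const q *
    (eta `^ (m%:R / 2 * q) * eta `^ N * eta `^ a *
     (lam `^ a * (1 - lam) `^ prior_b n k m alpha)) *
    expR (- (eta / 2 * (s + q * residual))).
Proof.
move=> e0 l01; rewrite /base_fun indicE mem_set ?mul1r//.
by split; rewrite /= in_itv/= ?e0.
Qed.

Lemma base_fun_ge0 q w : 0 <= base_fun q w.
Proof.
rewrite mulr_ge0// mulr_ge0 ?expR_ge0// mulr_ge0 ?(ltW (base_const_gt0 q))//.
by rewrite !mulr_ge0 ?powR_ge0.
Qed.

Lemma base_fun_neq0 q w : base_fun q w != 0 -> 0 < w.1 /\ 0 < w.2 < 1.
Proof.
rewrite /base_fun indicE; have [|_] := boolP (w \in E); last first.
  by rewrite mul0r eqxx.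
by rewrite inE => -[/=]; rewrite !in_itv/= andbT.
Qed.

Lemma measurable_base_fun q : measurable_fun setT (base_fun q).
Proof.
rewrite /base_fun; apply: measurable_funM.
  by apply: measurable_indic; exact: measurableX.
apply: measurable_funM; last first.
  apply: measurableT_comp => //; apply: measurableT_comp => //.
  by apply: measurable_funM => //; exact: measurable_funM.
apply: measurable_funM => //; apply: measurable_funM.
  apply: measurable_funM; last exact: (measurableT_comp (measurable_powR _)).
  by apply: measurable_funM; exact: (measurableT_comp (measurable_powR _)).
apply: measurable_funM; first exact: (measurableT_comp (measurable_powR _)).
apply: (measurableT_comp (measurable_powR _)).
exact: measurable_funB.
Qed.

Lemma density_vE theta eta : 0 < eta ->
  density_v d theta eta v =
  \prod_i normal_density1 (theta i ord0) (eta^-1 * d ord0 i) (v i ord0).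
Proof.
move=> e0; rewrite /density_v scale_diag_mx normal_density_diag => [|i].
  by apply: eq_bigr => i _; rewrite mxE.
by rewrite mxE mulr_gt0// invr_gt0.
Qed.

Lemma density_vstarE (mu0 : 'cV[R]_(k - l)) eta : 0 < eta ->
  density_vstar mu0 eta vstar =
  \prod_j normal_density1 (mu0 j ord0) (eta^-1 * 1) (vstar j ord0).
Proof.
move=> e0; rewrite /density_vstar scalar_diag_mx scale_diag_mx.
rewrite normal_density_diag => [|i]; last by rewrite !mxE mulr_gt0// invr_gt0.
by apply: eq_bigr => i _; rewrite !mxE.
Qed.

Lemma prior_thetaE theta eta lam : 0 < eta -> 0 < lam < 1 ->
  prior_theta d alpha c eta lam theta =
  \prod_i normal_density1 0
    (eta^-1 * (((d ord0 i)^-1 + beta)^-1 * (lam^-1 * c ord0 i - 1)))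
    (theta i ord0).
Proof.
move=> e0 /andP[l0 l1]; rewrite /prior_theta.
rewrite diag_mxV => [|i]; last by rewrite gt_eqF.
rewrite !scalar_diag_mx diag_mxD diag_mxV => [|i]; last first.
  by rewrite !mxE gt_eqF// prior_theta_prec_gt0.
rewrite scale_diag_mx diag_mxB diag_mxM scale_diag_mx.
rewrite normal_density_diag => [|i].
  by apply: eq_bigr => i _; rewrite !mxE.
rewrite !mxE mulr_gt0 ?invr_gt0// mulr_gt0 ?invr_gt0 ?prior_theta_prec_gt0//.
by rewrite subr_gt0 mulrC ltr_pdivlMr// mul1r (lt_le_trans l1).
Qed.

Lemma prior_muE (mu0 : 'cV[R]_(k - l)) eta lam : 0 < eta -> 0 < lam < 1 ->
  prior_mu gamma eta lam mu0 =
  \prod_j normal_density1 0 (eta^-1 * (1^-1 * (lam^-1 * gamma - 1)))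
    (mu0 j ord0).
Proof.
move=> e0 /andP[l0 l1]; rewrite /prior_mu scalar_diag_mx scale_diag_mx.
rewrite normal_density_diag => [|i].
  by apply: eq_bigr => i _; rewrite !mxE invr1 mul1r (mulrC gamma).
rewrite !mxE mulr_gt0 ?invr_gt0//.
by rewrite subr_gt0 ltr_pdivlMr// mul1r (lt_le_trans l1).
Qed.

Lemma density_y_powR theta eta q : 0 < eta ->
  density_y Q theta eta y `^ q =
  (2 * pi) `^ (- (m%:R / 2) * q) * eta `^ (m%:R / 2 * q) *
  expR (- (eta / 2 * (q * residual))) *
  \prod_i expR (- (q * (eta / 2 * (z i ord0 - theta i ord0) ^+ 2))).
Proof.
move=> e0; rewrite /density_y normal_density_iso// (sum_sqr_split y theta QQ).
have pow3 (x1 x2 x3 : R) : 0 <= x1 -> 0 <= x2 -> 0 <= x3 ->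
    (x1 * x2 * x3) `^ q = x1 `^ q * x2 `^ q * x3 `^ q.
  by move=> *; rewrite !powRM// mulr_ge0.
rewrite pow3 ?powR_ge0 ?expR_ge0// -!powRrM -expRM.
rewrite -[RHS]mulrA; congr (_ * _); rewrite -expR_sum -expRD; congr expR.
by rewrite -/residual sumrN -!mulr_sumr; ring.
Qed.

Lemma integrandE q theta (mu0 : 'cV[R]_(k - l)) eta lam :
  0 < eta -> 0 < lam < 1 ->
  density_y Q theta eta y `^ q *
  (density_v d theta eta v * density_vstar mu0 eta vstar * density_s n k eta s) *
  (prior_theta d alpha c eta lam theta * prior_mu gamma eta lam mu0 *
   eta `^ a * (lam `^ a * (1 - lam) `^ prior_b n k m alpha)) =
  base_fun q (eta, lam) * \prod_i theta_fun q i (theta i ord0) (eta, lam) *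
  \prod_j mu_fun j (mu0 j ord0) (eta, lam).
Proof.
move=> e0 l01; rewrite base_funE// density_y_powR// density_vE// density_vstarE//.
rewrite density_sE// prior_thetaE// prior_muE//.
have -> : \prod_i theta_fun q i (theta i ord0) (eta, lam) =
    (\prod_i normal_density1 (theta i ord0) (eta^-1 * d ord0 i) (v i ord0)) *
    (\prod_i normal_density1 0
      (eta^-1 * (((d ord0 i)^-1 + beta)^-1 * (lam^-1 * c ord0 i - 1)))
      (theta i ord0)) *
    \prod_i expR (- (q * (eta / 2 * (z i ord0 - theta i ord0) ^+ 2))).
  rewrite -!big_split/=; apply: eq_bigr => i _.
  by rewrite coord_fun_normal// prior_theta_prec_gt0.
have -> : \prod_j mu_fun j (mu0 j ord0) (eta, lam) =
    (\prod_j normal_density1 (mu0 j ord0) (eta^-1 * 1) (vstar j ord0)) *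
    (\prod_j normal_density1 0 (eta^-1 * (1^-1 * (lam^-1 * gamma - 1)))
    (mu0 j ord0)).
  rewrite -!big_split/=; apply: eq_bigr => i _.
  by rewrite /mu_fun -coord_fun_normal// mul0r oppr0 expR0 mulr1.
rewrite /base_const (mulrDr (eta / 2)) opprD expRD.
set P1 := \prod_i _; set P2 := \prod_i _; set P3 := \prod_i _.
set P4 := \prod_j _; set P5 := \prod_j _.
ring.
Qed.

Lemma normal_density1_gt0 (mean var x : R) : 0 < var ->
  0 < normal_density1 mean var x.
Proof.
move=> v0; rewrite /normal_density1 !mulr_gt0 ?expR_gt0 ?powR_gt0//.
by rewrite mulr_gt0// pi_gt0.
Qed.

(** Strict positivity matters: this factor is divided out in [integral_scale_likelihood]. *)
Lemma likelihood_gt0 q theta (mu0 : 'cV[R]_(k - l)) eta : 0 < eta ->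
  0 < density_y Q theta eta y `^ q *
    (density_v d theta eta v * density_vstar mu0 eta vstar * density_s n k eta s).
Proof.
move=> e0; have N0 := dimension_gt0.
have p0 : 0 < 2 * pi :> R by rewrite mulr_gt0// pi_gt0.
rewrite mulr_gt0//.
  apply: powR_gt0; rewrite /density_y normal_density_iso//.
  by rewrite !mulr_gt0 ?(powR_gt0 _ p0) ?(powR_gt0 _ e0) ?expR_gt0.
rewrite mulr_gt0//; last first.
  rewrite density_sE// mulr_gt0 ?divr_gt0 ?mulr_gt0 ?(powR_gt0 _ s0) ?(powR_gt0 _ e0)
    ?expR_gt0 ?(powR_gt0 _ (@ltr0Sn R 1)) ?Gamma_gt0//.
by rewrite density_vE// density_vstarE// mulr_gt0// prodr_gt0// => i _;
  rewrite normal_density1_gt0// mulr_gt0 ?invr_gt0.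
Qed.

(* The factor kap stands for the normalizing constant of the posterior: carrying
   it along avoids pulling it out of three nested integrals afterwards. *)
Definition joint_fun kap q (theta : 'cV[R]_l) (mu0 : 'cV[R]_(k - l)) (w : R * R) :=
  kap * base_fun q w * \prod_i theta_fun q i (theta i ord0) w *
  \prod_j mu_fun j (mu0 j ord0) w.

Lemma theta_fun_ge0 q i t w : 0 <= q -> base_fun q w != 0 -> 0 <= theta_fun q i t w.
Proof. by move=> q0 /base_fun_neq0[w0 _]; exact: coord_fun_ge0. Qed.

Lemma mu_fun_ge0 q j t w : base_fun q w != 0 -> 0 <= mu_fun j t w.
Proof. by move=> /base_fun_neq0[w0 _]; exact: coord_fun_ge0. Qed.

Lemma joint_fun_ge0 kap q theta mu0 w : 0 <= kap -> 0 <= q ->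
  0 <= joint_fun kap q theta mu0 w.
Proof.
move=> kap0 q0; rewrite /joint_fun; have [->|b0] := eqVneq (base_fun q w) 0.
  by rewrite mulr0 !mul0r.
apply: mulr_ge0; last by apply: prodr_ge0 => j _; exact: mu_fun_ge0 b0.
apply: mulr_ge0; first by rewrite mulr_ge0 ?base_fun_ge0.
by apply: prodr_ge0 => i _; exact: theta_fun_ge0.
Qed.

Lemma measurable_theta_fun q i :
  measurable_fun setT (fun p : R * (R * R) => theta_fun q i p.1 p.2).
Proof. exact: measurable_coord_fun. Qed.

Lemma measurable_mu_fun j :
  measurable_fun setT (fun p : R * (R * R) => mu_fun j p.1 p.2).
Proof. exact: measurable_coord_fun. Qed.

Lemma measurable_base_theta_fun kap q (theta : 'cV[R]_l) :
  measurable_fun setT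
    (fun w => kap * base_fun q w * \prod_i theta_fun q i (theta i ord0) w).
Proof.
apply: measurable_funM.
  by apply: measurable_funM => //; exact: measurable_base_fun.
apply: measurable_prod => i _.
exact: (measurableT_comp (measurable_theta_fun q i) (pair1_measurable _)).
Qed.

Lemma measurable_joint_fun kap q theta mu0 :
  measurable_fun setT (joint_fun kap q theta mu0).
Proof.
apply: measurable_funM; first exact: measurable_base_theta_fun.
apply: measurable_prod => i _.
exact: (measurableT_comp (measurable_mu_fun i) (pair1_measurable _)).
Qed.

(** Tonelli merges the eta integral with the lambda integral of the prior; the indicator in
    [base_fun] accounts for both domains. *)
Lemma integral_scale_likelihood kap q theta (mu0 : 'cV[R]_(k - l)) :
  0 < kap -> 0 <= q ->
  (\int[mu]_(eta in `]0%R, +oo[)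
     ((density_y Q theta eta y `^ q)%:E *
      (likelihood_prior n m d alpha a c gamma v vstar s theta mu0 eta * kap%:E)) =
   \int[mu \x mu]_w (joint_fun kap q theta mu0 w)%:E)%E.
Proof.
move=> kap0 q0; have mj := measurable_joint_fun kap q theta mu0.
have kap1 := ltW kap0.
rewrite (@fubini_tonelli1 _ _ (measurableTypeR R) (measurableTypeR R) R mu mu
  (EFin \o joint_fun kap q theta mu0)); last 2 first.
- exact/measurable_EFinP.
- by move=> w; rewrite lee_fin joint_fun_ge0.
rewrite integral_mkcond; apply: eq_integral => eta _; rewrite /fubini_F patchE.
have j0 lam : ~ E (eta, lam) -> joint_fun kap q theta mu0 (eta, lam) = 0.
  by move=> nE; rewrite /joint_fun /base_fun indicE memNset// mul0r mulr0 !mul0r.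
have [|] := boolP (eta \in `]0, +oo[%classic); last first.
  rewrite notin_setE/= => ne; rewrite integral0_eq// => lam _ /=.
  by rewrite j0// => -[].
rewrite inE/= in_itv/= andbT => e0.
have := mulr_gt0 kap0 (likelihood_gt0 q theta mu0 e0); set L := (X in 0 < X) => L0.
rewrite /likelihood_prior /prior.
rewrite (_ : (_ * (_ * _ * _))%E = (L%:E * \int[mu]_(lam in `]0%R, 1%R[)
     (prior_theta d alpha c eta lam theta * prior_mu gamma eta lam mu0 *
      eta `^ a * (lam `^ a * (1 - lam) `^ prior_b n k m alpha))%:E)%E); last first.
  by rewrite muleAC -EFinM muleA -EFinM; congr (_%:E * _)%E; rewrite /L; ring.
transitivity (\int[mu]_(lam in `]0%R, 1%R[) (joint_fun kap q theta mu0 (eta, lam))%:E)%E;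
  last first.
  rewrite integral_mkcond; apply: eq_integral => lam _; rewrite patchE.
  case: ifPn => //; rewrite notin_setE/= => nl; rewrite j0// => -[_ /=].
  by move: nl.
have mE : measurable_fun (`]0%R, 1%R[%classic : set R)
    (fun lam => (joint_fun kap q theta mu0 (eta, lam))%:E).
  apply/measurable_EFinP/measurable_funTS.
  exact: (measurableT_comp mj (pair1_measurable _)).
(* Written as [L^-1] times [joint_fun], the prior integrand inherits its measurability in lambda, so
   no matrix density has to be shown measurable. The constant can then be pulled out even if the
   integral is infinite. *)
rewrite (_ : (\int[mu]_(lambda in _) _)%E =
   (\int[mu]_(lam in `]0%R, 1%R[)
     ((L^-1)%:E * (joint_fun kap q theta mu0 (eta, lam))%:E))%E); last first.
  apply: eq_integral => lam; rewrite inE/= in_itv/= => l01.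
  rewrite -EFinM; congr EFin; rewrite /joint_fun -!(mulrA kap) -integrandE//.
  by rewrite (mulrA kap) mulKf// gt_eqF.
rewrite ge0_integralZl_EFin//; last 2 first.
- by move=> lam _; rewrite lee_fin joint_fun_ge0.
- by rewrite invr_ge0 ltW.
by rewrite muleA -EFinM mulfV ?mul1e// gt_eqF.
Qed.

Definition theta_value q (i : 'I_l) : R * R -> R :=
  coord_value (v i ord0) (d ord0 i) ((d ord0 i)^-1 + beta) (c ord0 i) q
    (z i ord0).

Definition mu_value (j : 'I_(k - l)) : R * R -> R :=
  coord_value (vstar j ord0) 1 1 gamma 0 0.

(** Two uses of [ge0_tonelli_tuple_prod]: for mu with the theta factors inside the weight, then for
    theta with the integrated mu factors inside it. *)
Lemma hierarchical_integral kap q : 0 < kap -> 0 <= q ->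
  (integral_psi (fun theta (mu0 : 'cV[R]_(k - l)) eta =>
     (density_y Q theta eta y `^ q)%:E *
     (likelihood_prior n m d alpha a c gamma v vstar s theta mu0 eta * kap%:E)) =
   \int[mu \x mu]_w (kap * base_fun q w * \prod_i theta_value q i w *
     \prod_j mu_value j w)%:E)%E.
Proof.
move=> kap0 q0; have kap1 := ltW kap0; rewrite /integral_psi /integral_cV.
have [nu nuE] := @product_sigma_finiteP _ _ (measurableTypeR R)
  (measurableTypeR R) R mu mu.
have int_mu (theta : 'cV[R]_l) :
    (\int[tuple_measure mu (k - l)]_t \int[nu]_w
       (kap * base_fun q w * \prod_i theta_fun q i (theta i ord0) w *
        \prod_j mu_fun j (tnth t j) w)%:E =
     \int[nu]_w (kap * base_fun q w * \prod_i theta_fun q i (theta i ord0) w *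
        \prod_j mu_value j w)%:E)%E.
  apply: (@ge0_tonelli_tuple_prod _ (measurableTypeR R) R mu _ _ nu (k - l)
    (fun w => kap * base_fun q w * \prod_i theta_fun q i (theta i ord0) w)
    mu_fun mu_value).
  - exact: measurable_base_theta_fun.
  - move=> w; have [->|b0] := eqVneq (base_fun q w) 0; first by rewrite mulr0 mul0r.
    rewrite mulr_ge0 ?(mulr_ge0 kap1) ?base_fun_ge0// prodr_ge0// => i _.
    exact: theta_fun_ge0.
  - exact: measurable_mu_fun.
  - move=> j x w H; apply: (@mu_fun_ge0 q).
    by apply: contra_neq H => ->; rewrite mulr0 mul0r.
  - by move=> j; exact: measurable_coord_value.
  - move=> j w H; have [|w0 w1] := @base_fun_neq0 q w.
      by apply: contra_neq H => ->; rewrite mulr0 mul0r.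
    exact: integral_coord_fun.
transitivity (\int[tuple_measure mu l]_t \int[nu]_w
    (kap * base_fun q w * \prod_j mu_value j w *
     \prod_i theta_fun q i (tnth t i) w)%:E)%E.
  apply: eq_integral => t _.
  transitivity (\int[tuple_measure mu (k - l)]_t' \int[nu]_w
    (kap * base_fun q w * \prod_i theta_fun q i ((\col_i tnth t i) i ord0) w *
        \prod_j mu_fun j (tnth t' j) w)%:E)%E.
    apply: eq_integral => t' _; rewrite integral_scale_likelihood// nuE.
    apply: eq_integral => w _; rewrite /joint_fun.
    by congr (_ * _)%:E; apply: eq_bigr => j _; rewrite mxE.
  rewrite int_mu; apply: eq_integral => w _; rewrite mulrAC.
  by congr (_ * _)%:E; apply: eq_bigr => i _; rewrite mxE.
rewrite (@ge0_tonelli_tuple_prod _ (measurableTypeR R) R mu _ _ nu l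
    (fun w => kap * base_fun q w * \prod_j mu_value j w)
    (theta_fun q) (theta_value q)).
- rewrite nuE; by apply: eq_integral => w _; rewrite mulrAC.
- apply: measurable_funM.
    by apply: measurable_funM => //; exact: measurable_base_fun.
  by apply: measurable_prod => j _; exact: measurable_coord_value.
- move=> w; have [->|b0] := eqVneq (base_fun q w) 0; first by rewrite mulr0 mul0r.
  have [w0 w1] := base_fun_neq0 b0.
  rewrite mulr_ge0 ?(mulr_ge0 kap1) ?base_fun_ge0// prodr_ge0// => j _.
  by apply/ltW/coord_value_gt0.
- exact: measurable_theta_fun.
- move=> i x w H; apply: theta_fun_ge0 => //.
  by apply: contra_neq H => ->; rewrite mulr0 mul0r.
- by move=> i; exact: measurable_coord_value.
- move=> i w H; have [|w0 w1] := @base_fun_neq0 q w.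
    by apply: contra_neq H => ->; rewrite mulr0 mul0r.
  apply: integral_coord_fun w0 w1 => //; exact: prior_theta_prec_gt0.
Qed.

End hierarchical.

(** * The predictive density *)

Section predictive_forms.
Context {R : realType}.
Variables (m l : nat) (d : 'rV[R]_l) (Q : 'M[R]_(m, l)) (alpha : R) (c : 'rV[R]_l).
Variables (v : 'cV[R]_l) (y : 'cV[R]_m).
Hypotheses (d0 : forall i, 0 < d ord0 i) (QQ : Q^T *m Q = 1%:M).
Hypotheses (alpha1 : alpha < 1) (c1 : forall i, 1 <= c ord0 i).

Local Notation beta := ((1 - alpha) / 2).
Local Notation z := (Q^T *m y).

Lemma inv_beta : 2 / (1 - alpha) = beta^-1.
Proof. by rewrite invf_div. Qed.

(** [Sigma_U] has eigenvalue 1/beta off the range of Q and 1/beta + d_i on it. The summands are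
    those of [coord_valueE] at lambda = 0 and q = beta. *)
Lemma qform_Sigma_U :
  qform (invmx (Sigma_U d Q alpha)) (y - Q *m v) =
  beta * residual Q y +
  \sum_i beta * (v i ord0 - z i ord0) ^+ 2 / (1 + beta * d ord0 i).
Proof.
have b0 : 0 < beta by exact: beta_gt0.
rewrite /Sigma_U inv_beta; move: beta b0 => b b0.
rewrite qform_range ?invr_gt0// => [|i]; last exact: ltW.
rewrite invrK mulrC; congr (_ + _); apply: eq_bigr => i _.
have b1 : 0 < 1 + b * d ord0 i by rewrite addr_gt0// mulr_gt0.
have b2 : 0 < b^-1 + d ord0 i by rewrite addr_gt0// invr_gt0.
by field; rewrite !gt_eqF.
Qed.

Let cd0 i : 0 < c ord0 i + beta * d ord0 i.
Proof.
apply: addr_gt0; first exact: lt_le_trans (c1 i).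
by apply: mulr_gt0; [exact: beta_gt0|exact: d0].
Qed.

Lemma diag_mx_mean :
  (diag_mx c - 1%:M) *m invmx (diag_mx c + beta *: diag_mx d) =
  diag_mx (\row_i ((c ord0 i - 1) / (c ord0 i + beta * d ord0 i))).
Proof.
rewrite scalar_diag_mx scale_diag_mx diag_mxD diag_mxB diag_mxV => [|i].
  by rewrite diag_mxM; congr diag_mx; apply/rowP => i; rewrite !mxE.
by rewrite !mxE gt_eqF.
Qed.

Lemma diag_mx_cov :
  (diag_mx c - 1%:M) *m diag_mx d *m invmx (diag_mx c + beta *: diag_mx d) =
  diag_mx (\row_i ((c ord0 i - 1) * d ord0 i / (c ord0 i + beta * d ord0 i))).
Proof.
rewrite scalar_diag_mx scale_diag_mx diag_mxD diag_mxB diag_mxV => [|i].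
  by rewrite !diag_mxM; congr diag_mx; apply/rowP => i; rewrite !mxE.
by rewrite !mxE gt_eqF.
Qed.

Lemma theta_BE i : theta_B d alpha c v i ord0 =
  (c ord0 i - 1) / (c ord0 i + beta * d ord0 i) * v i ord0.
Proof. by rewrite /theta_B diag_mx_mean mul_diag_mx !mxE. Qed.

Lemma R_vE : R_v d alpha c v =
  \sum_i (beta * d ord0 i + 1) / (d ord0 i * (c ord0 i + beta * d ord0 i)) *
    v i ord0 ^+ 2.
Proof.
rewrite /R_v scale_diag_mx scalar_diag_mx !diag_mxD !diag_mxV => [|i|i].
- rewrite !diag_mxM qform_diag; apply: eq_bigr => i _; rewrite !mxE.
  by rewrite invfM (mulrA (_ + 1)).
- by rewrite !mxE gt_eqF.
- by rewrite gt_eqF.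
Qed.

(** A square completed in each z_i: the right side is the exponent at lambda = 1, its minimizer is
    the i-th entry of [theta_B], and the minimum is the i-th term of [R_v]. The curvature comes from
    1/beta + (c-1)d/(c + beta d) = c(1 + beta d) / (beta (c + beta d)). *)
Lemma qform_Sigma_B :
  qform (invmx (Sigma_B d Q alpha c)) (y - Q *m theta_B d alpha c v) +
  R_v d alpha c v =
  beta * residual Q y +
  \sum_i beta * (v i ord0 - z i ord0) ^+ 2 / (1 + beta * d ord0 i) +
  \sum_i (v i ord0 + beta * d ord0 i * z i ord0) ^+ 2 /
    (c ord0 i * d ord0 i * (1 + beta * d ord0 i)).
Proof.
have b0 : 0 < beta by exact: beta_gt0.
rewrite /Sigma_B -!(mulmxA Q) diag_mx_cov inv_beta.
have e0 i : 0 <= (\row_i ((c ord0 i - 1) * d ord0 i /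
    (c ord0 i + beta * d ord0 i))) ord0 i.
  rewrite mxE; apply: divr_ge0; last exact: ltW.
  by rewrite mulr_ge0 ?subr_ge0// ltW.
rewrite mulmxA qform_range ?invr_gt0// invrK R_vE mulrC -!addrA; congr (_ + _).
rewrite -!big_split/=; apply: eq_bigr => i _; rewrite theta_BE !mxE.
move: (c1 i) (cd0 i) (d0 i) => ci1 cdi di; move: beta b0 cdi => b b0 cdi.
have ci0 : 0 < c ord0 i by exact: lt_le_trans ci1.
have b1 : 0 < 1 + b * d ord0 i by rewrite addr_gt0// mulr_gt0.
have b2 : 0 < b^-1 + (c ord0 i - 1) * d ord0 i / (c ord0 i + b * d ord0 i).
  rewrite ltr_pwDl ?invr_gt0// divr_ge0 ?(ltW cdi)// mulr_ge0 ?subr_ge0//.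
  exact: ltW.
rewrite (_ : b^-1 + _ = c ord0 i * (1 + b * d ord0 i) / (b * (c ord0 i + b * d ord0 i)));
  last by field; rewrite !gt_eqF.
by field; rewrite !gt_eqF.
Qed.

End predictive_forms.

(** * Closed form of the kernel integral, bounds on the evidence *)

Section marginal.
Context {R : realType}.
Variables (n k m l : nat).
Variables (d : 'rV[R]_l) (Q : 'M[R]_(m, l)) (alpha a : R) (c : 'rV[R]_l) (gamma : R).
Variables (v : 'cV[R]_l) (vstar : 'cV[R]_(k - l)) (s : R).
Hypotheses (kn : (k < n)%N) (lk : (l <= k)%N).
Hypotheses (d0 : forall i, 0 < d ord0 i) (QQ : Q^T *m Q = 1%:M).
Hypotheses (alpha1 : alpha < 1) (c1 : forall i, 1 <= c ord0 i).
Hypotheses (gamma1 : 1 <= gamma) (s0 : 0 < s) (ha : - (k%:R / 2) - 1 < a).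

Local Notation beta := ((1 - alpha) / 2).
Local Notation N := ((n - k)%:R / 2 : R).
Local Notation mu := (@lebesgue_measure R).

Definition rate_U (y : 'cV[R]_m) : R :=
  qform (invmx (Sigma_U d Q alpha)) (y - Q *m v) + s.

Definition rate_B (y : 'cV[R]_m) : R :=
  qform (invmx (Sigma_B d Q alpha c)) (y - Q *m theta_B d alpha c v) +
  R_v d alpha c v + (\sum_i vstar i ord0 ^+ 2) / gamma + s.

(** The shape a1: each of the k coordinates adds 1/2 to the prior exponent of lambda, and the
    assumed lower bound on [a] says that this shape is positive. The shape a2 is
    [shape_eta beta]. *)
Definition shape_lam : R := a + k%:R / 2 + 1.
Definition shape_eta (q : R) : R := m%:R / 2 * q + N.

Lemma residual_ge0 (y : 'cV[R]_m) : 0 <= residual Q y.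
Proof. by apply: sumr_ge0 => i _; exact: sqr_ge0. Qed.

Lemma shape_lam_gt0 : 0 < shape_lam.
Proof. by move: ha; rewrite /shape_lam; lra. Qed.

Lemma shape_eta_gt0 q : 0 <= q -> 0 < shape_eta q.
Proof. by move=> q0; rewrite ltr_wpDl ?dimension_gt0// mulr_ge0. Qed.

Lemma rate_U_ge y : s <= rate_U y.
Proof.
rewrite /rate_U (qform_Sigma_U v y d0 QQ alpha1) lerDr addr_ge0//.
  by rewrite mulr_ge0 ?residual_ge0// ltW// beta_gt0.
apply: sumr_ge0 => i _; apply: divr_ge0.
  by rewrite mulr_ge0 ?sqr_ge0// ltW// beta_gt0.
by rewrite addr_ge0// mulr_ge0// ltW// beta_gt0.
Qed.

(** Twice the coefficient r of lambda in the exponent; [rate_U] is likewise twice p. *)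
Definition excess (y : 'cV[R]_m) : R :=
  \sum_i (v i ord0 + beta * d ord0 i * (Q^T *m y) i ord0) ^+ 2 /
    (c ord0 i * d ord0 i * (1 + beta * d ord0 i)) +
  (\sum_i vstar i ord0 ^+ 2) / gamma.

Lemma rate_BE y : rate_B y = rate_U y + excess y.
Proof.
rewrite /rate_B (qform_Sigma_B v y d0 QQ alpha1 c1) /rate_U.
rewrite (qform_Sigma_U v y d0 QQ alpha1) /excess.
ring.
Qed.

Lemma excess_ge0 y : 0 <= excess y.
Proof.
apply: addr_ge0; last first.
  by rewrite divr_ge0 ?(le_trans _ gamma1)// sumr_ge0// => i _; rewrite sqr_ge0.
apply: sumr_ge0 => i _; rewrite divr_ge0 ?sqr_ge0//.
have b0 := beta_gt0 alpha1; have ci : 0 < c ord0 i by exact: lt_le_trans (c1 i).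
have di := d0 i; have bd : 0 < 1 + beta * d ord0 i by rewrite addr_gt0// mulr_gt0.
by apply/ltW; rewrite !mulr_gt0.
Qed.

Lemma prod_coord_value (I : finType) (x C p r : I -> R) (w : R * R) :
  (forall i, x i = C i * (w.1 `^ 2^-1 * w.2 `^ 2^-1) *
     expR (- (w.1 * (p i / 2 + w.2 * (r i / 2))))) ->
  \prod_i x i = \prod_i C i * (w.1 `^ (#|I|%:R / 2) * w.2 `^ (#|I|%:R / 2)) *
     expR (- (w.1 * ((\sum_i p i) / 2 + w.2 * ((\sum_i r i) / 2)))).
Proof.
move=> xE; rewrite (eq_bigr _ (fun i _ => xE i)) !big_split/=.
congr (_ * _ * _).
  rewrite !prodr_const -!powR_mulrn ?powR_ge0// -!powRrM.
  by rewrite !(mulrC 2^-1).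
rewrite -expR_sum; congr expR; rewrite sumrN -mulr_sumr big_split/=.
by rewrite -mulr_sumr -!mulr_suml.
Qed.

Definition coord_const : R :=
  \prod_i (2 * pi * (c ord0 i * d ord0 i)) `^ (- 2^-1) *
  \prod_(j < k - l) (2 * pi * (gamma * 1)) `^ (- 2^-1).

Lemma coord_const_gt0 : 0 < coord_const.
Proof.
have p0 : 0 < 2 * pi :> R by rewrite mulr_gt0// pi_gt0.
have g0 : 0 < gamma by exact: lt_le_trans gamma1.
apply: mulr_gt0; apply: prodr_gt0 => i _; apply: powR_gt0; apply: mulr_gt0 => //.
  by apply: mulr_gt0 => //; exact: lt_le_trans (c1 i).
by rewrite mulr1.
Qed.

(** Exponents are matched: eta collects m beta / 2 + N + a + k/2, lambda collects a + k/2, and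
    [prior_b] is exactly [shape_eta beta - 1]. *)
Lemma marginal_funE y w :
  base_fun n k Q alpha a s y beta w *
    \prod_i theta_value d Q alpha c v y beta i w *
    \prod_j mu_value gamma vstar j w =
  base_const n k m s beta * coord_const *
  gamma_beta_fun shape_lam (shape_eta beta) (rate_U y / 2) (excess y / 2) w.
Proof.
have [|nE] := boolP (w \in (`]0%R, +oo[%classic `*` `]0%R, 1%R[%classic : set (R * R)));
  last by rewrite /base_fun /gamma_beta_fun !indicE (negbTE nE) !(mul0r, mulr0).
rewrite inE => -[]; rewrite /= !in_itv/= andbT.
case: w => eta lam /= e0 l01; have [l0 l1] := andP l01.
have b0 := ltW (beta_gt0 alpha1).
rewrite base_funE//.
rewrite (@prod_coord_value _
  (fun i => theta_value d Q alpha c v y beta i (eta, lam))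
  (fun i => (2 * pi * (c ord0 i * d ord0 i)) `^ (- 2^-1))
  (fun i => beta * (v i ord0 - (Q^T *m y) i ord0) ^+ 2 / (1 + beta * d ord0 i))
  (fun i => (v i ord0 + beta * d ord0 i * (Q^T *m y) i ord0) ^+ 2 /
    (c ord0 i * d ord0 i * (1 + beta * d ord0 i))) (eta, lam)); last first.
  by move=> i; rewrite /theta_value coord_valueE.
rewrite (@prod_coord_value _ (fun j => mu_value gamma vstar j (eta, lam))
  (fun j => (2 * pi * (gamma * 1)) `^ (- 2^-1)) (fun=> 0)
  (fun j => vstar j ord0 ^+ 2 / gamma) (eta, lam)); last first.
  (* kap = 1 is put in the form 1/d + q with d = 1 and q = 0, as [coord_valueE] expects. *)
  move=> j; rewrite /mu_value -[X in coord_value _ _ X](_ : 1^-1 + 0 = 1); last first.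
    by rewrite invr1 addr0.
  by rewrite coord_valueE// !(mul0r, mulr0, addr0, mulr1).
rewrite /= !card_ord.
rewrite (_ : \sum_j vstar j ord0 ^+ 2 / gamma = (\sum_j vstar j ord0 ^+ 2) / gamma);
  last by rewrite mulr_suml.
rewrite /gamma_beta_fun indicE mem_set ?mul1r//; last first.
  by split; rewrite /= in_itv/= ?e0.
rewrite /= /coord_const.
rewrite (_ : \sum_(j < k - l) (0 : R) = 0); last by rewrite big1.
set S3 := (\sum_j vstar j ord0 ^+ 2) / gamma.
set CT := \prod_i _; set CM := \prod_(j < k - l) _.
set S1 := \sum_i _; set S2 := \sum_i _.
have lE : k%:R = l%:R + (k - l)%:R :> R by rewrite -natrD subnKC.
have etaE : eta `^ (shape_lam + shape_eta beta - 1) =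
    eta `^ (m%:R / 2 * beta) * eta `^ N * eta `^ a *
    (eta `^ (l%:R / 2) * eta `^ ((k - l)%:R / 2)).
  rewrite -!powRD ?(gt_eqF e0) ?implybT//; congr powR.
  by rewrite /shape_lam /shape_eta lE; field.
have lamE : lam `^ (shape_lam - 1) =
    lam `^ a * (lam `^ (l%:R / 2) * lam `^ ((k - l)%:R / 2)).
  rewrite -!powRD ?(gt_eqF l0) ?implybT//; congr powR.
  by rewrite /shape_lam lE; field.
have bE : shape_eta beta - 1 = prior_b n k m alpha.
  by rewrite /shape_eta /prior_b; field.
have rE : rate_U y = s + beta * residual Q y + S1.
  rewrite /rate_U (qform_Sigma_U v y d0 QQ alpha1) /S1; ring.
have xE : excess y = S2 + S3 by [].
rewrite etaE lamE bE rE xE.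
have -> : - (eta * ((s + beta * residual Q y + S1) / 2 + lam * ((S2 + S3) / 2))) =
    - (eta / 2 * (s + beta * residual Q y)) +
    (- (eta * (S1 / 2 + lam * (S2 / 2))) + - (eta * (0 / 2 + lam * (S3 / 2)))).
  by field.
rewrite !expRD.
clearbody S1 S2 S3 CT CM.
move: (expR (- (eta / 2 * _))) (expR (- (eta * (S1 / 2 + _)))).
move: (expR (- (eta * (0 / 2 + _)))) => X1 X2 X3.
move: (base_const _ _ _ _ _) => B0.
ring.
Qed.

Lemma hierarchical_integralE kap y : 0 < kap ->
  (integral_psi (fun theta (mu0 : 'cV[R]_(k - l)) eta =>
     (density_y Q theta eta y `^ beta)%:E *
     (likelihood_prior n m d alpha a c gamma v vstar s theta mu0 eta * kap%:E)) =
   (kap * (base_const n k m s beta * coord_const) *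
    (Gamma shape_lam * Gamma (shape_eta beta) *
     (rate_U y / 2) `^ (- shape_eta beta) *
     (rate_B y / 2) `^ (- shape_lam)))%:E)%E.
Proof.
move=> kap0; have b0 := ltW (beta_gt0 alpha1).
have U0 : 0 < rate_U y by apply: lt_le_trans s0 (rate_U_ge y).
have X0 := excess_ge0 y.
rewrite hierarchical_integral//.
have reassoc (x1 x2 x3 x4 : R) : x1 * x2 * x3 * x4 = x1 * (x2 * x3 * x4) by ring.
under eq_integral => w _ do rewrite reassoc marginal_funE (mulrA kap) EFinM.
rewrite ge0_integralZl_EFin//; last 3 first.
- by move=> w _; rewrite lee_fin gamma_beta_fun_ge0.
- by apply/measurable_EFinP; exact: measurable_gamma_beta_fun.
- apply: mulr_ge0; first exact: ltW.
  by apply/ltW/mulr_gt0; [exact: base_const_gt0|exact: coord_const_gt0].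
rewrite integral_gamma_beta_fun.
- by rewrite -EFinM rate_BE (mulrDl (rate_U y)).
- exact: shape_lam_gt0.
- exact: shape_eta_gt0.
- exact: divr_gt0.
- by rewrite ltr_pwDl ?divr_gt0// divr_ge0.
Qed.

Local Notation E := (`]0%R, +oo[%classic `*` `]0%R, 1%R[%classic : set (R * R)).

(** With q = 0 the future density is raised to the power 0, so the choice y = 0 is arbitrary. *)
Definition evidence_fun (w : R * R) : R :=
  base_fun n k Q alpha a s 0 0 w *
    \prod_i theta_value d Q alpha c v 0 0 i w *
    \prod_j mu_value gamma vstar j w.

Lemma evidenceE :
  (integral_psi (likelihood_prior n m d alpha a c gamma v vstar s) =
   \int[mu \x mu]_w (evidence_fun w)%:E)%E.
Proof.
transitivity (\int[mu \x mu]_w (1 * base_fun n k Q alpha a s 0 0 w *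
    \prod_i theta_value d Q alpha c v 0 0 i w *
    \prod_j mu_value gamma vstar j w)%:E)%E; last first.
  by apply: eq_integral => w _; rewrite mul1r.
rewrite -(hierarchical_integral a v vstar 0 kn d0 QQ alpha1 c1 gamma1 s0 ltr01 (lexx 0)).
congr integral_psi; apply/funext => theta; apply/funext => mu0.
by apply/funext => eta; rewrite powRr0 mul1e mule1.
Qed.

Lemma evidence_fun0 w : ~ E w -> evidence_fun w = 0.
Proof. by move=> nE; rewrite /evidence_fun /base_fun indicE memNset// !mul0r. Qed.

Lemma evidence_fun_gt0 w : E w -> 0 < evidence_fun w.
Proof.
case: w => eta lam [/=]; rewrite !in_itv/= andbT => e0 l01; have [l0 l1] := andP l01.
rewrite /evidence_fun base_funE//; apply: mulr_gt0; first apply: mulr_gt0.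
- apply: mulr_gt0; last exact: expR_gt0.
  apply: mulr_gt0; first exact: base_const_gt0.
  by rewrite !mulr_gt0 ?powR_gt0// subr_gt0.
- apply: prodr_gt0 => i _; apply: coord_value_gt0 => //.
  exact: prior_theta_prec_gt0.
- by apply: prodr_gt0 => i _; exact: coord_value_gt0.
Qed.

Lemma evidence_fun_ge0 w : 0 <= evidence_fun w.
Proof.
have [Ew|nE] := pselect (E w); first exact/ltW/evidence_fun_gt0.
by rewrite evidence_fun0.
Qed.

Lemma measurable_evidence_fun : measurable_fun setT evidence_fun.
Proof.
apply: measurable_funM; first apply: measurable_funM.
- exact: measurable_base_fun.
- by apply: measurable_prod => i _; exact: measurable_coord_value.
- by apply: measurable_prod => i _; exact: measurable_coord_value.
Qed.

Lemma evidence_gt0 :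
  (0 < integral_psi (likelihood_prior n m d alpha a c gamma v vstar s))%E.
Proof.
rewrite evidenceE.
rewrite (_ : (\int[_]_w _)%E =
    (\int[mu \x mu]_(w in E) (evidence_fun w)%:E)%E); last first.
  rewrite [RHS]integral_mkcond; apply: eq_integral => w _; rewrite patchE.
  by case: ifPn => //; rewrite notin_setE => /evidence_fun0 ->.
have mE : ((mu \x mu)%E E = +oo)%E.
  rewrite product_measure1E//= !lebesgue_measure_itv/= ltry lte_fin ltr01.
  by rewrite oppr0 !adde0 mule1.
have mE0 : (0 < (mu \x mu)%E E)%E by rewrite mE.
apply: (ge0_integral_gt0 _ mE0).
- exact: measurableX.
- by apply/measurable_EFinP/measurable_funTS; exact: measurable_evidence_fun.
- by move=> w Ew; rewrite lte_fin evidence_fun_gt0.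
Qed.

Definition evidence_bound : R :=
  base_const n k m s 0 *
  (\prod_i ((2 * pi) `^ (- 2^-1) * ((d ord0 i)^-1 + beta) `^ 2^-1) *
   \prod_(j < k - l) ((2 * pi) `^ (- 2^-1) * (1^-1 + 0) `^ 2^-1)).

Lemma prod_half_powR (I : finType) (x C : I -> R) (w : R * R) :
  (forall i, 0 <= x i <= C i * (w.1 `^ 2^-1 * w.2 `^ 2^-1)) ->
  \prod_i x i <= \prod_i C i * (w.1 `^ (#|I|%:R / 2) * w.2 `^ (#|I|%:R / 2)).
Proof.
move=> xC; apply: (@le_trans _ _ (\prod_i (C i * (w.1 `^ 2^-1 * w.2 `^ 2^-1)))).
  by apply: ler_prod => i _; exact: xC.
rewrite !big_split/= !prodr_const -!powR_mulrn ?powR_ge0// -!powRrM.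
by rewrite !(mulrC 2^-1).
Qed.

(** At q = 0 the power of eta forces the second shape to be N. The matching exponent N - 1 of 1 -
    lambda is at most [prior_b], so replacing the latter only enlarges the integrand on ]0, 1[. *)
Lemma evidence_fun_le w : evidence_fun w <=
  evidence_bound * gamma_beta_fun shape_lam N (s / 2) 0 w.
Proof.
have [Ew|nE] := pselect (E w); last first.
  by rewrite evidence_fun0// /gamma_beta_fun indicE memNset// mul0r mulr0.
rewrite /gamma_beta_fun indicE mem_set// mul1r.
move: Ew; case: w => eta lam [/=]; rewrite !in_itv/= andbT => e0 l01.
have [l0 l1] := andP l01.
rewrite /evidence_fun base_funE//.
have ub1 : \prod_i theta_value d Q alpha c v 0 0 i (eta, lam) <=
    \prod_i ((2 * pi) `^ (- 2^-1) * ((d ord0 i)^-1 + beta) `^ 2^-1) *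
    (eta `^ (l%:R / 2) * lam `^ (l%:R / 2)).
  have := @prod_half_powR _ (fun i => theta_value d Q alpha c v 0 0 i (eta, lam))
    (fun i => (2 * pi) `^ (- 2^-1) * ((d ord0 i)^-1 + beta) `^ 2^-1) (eta, lam).
  rewrite card_ord/=; apply => i.
  rewrite ltW /theta_value; last first.
    by apply: coord_value_gt0 => //; exact: prior_theta_prec_gt0.
  rewrite mulmx0 mxE; apply: coord_value0_le => //.
  exact/ltW/beta_gt0.
have ub2 : \prod_j mu_value gamma vstar j (eta, lam) <=
    \prod_(j < k - l) ((2 * pi) `^ (- 2^-1) * (1^-1 + 0) `^ 2^-1) *
    (eta `^ ((k - l)%:R / 2) * lam `^ ((k - l)%:R / 2)).
  have := @prod_half_powR _ (fun j => mu_value gamma vstar j (eta, lam))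
    (fun=> (2 * pi) `^ (- 2^-1) * (1^-1 + 0) `^ 2^-1) (eta, lam).
  rewrite card_ord/=; apply => j.
  rewrite ltW /mu_value; last exact: coord_value_gt0.
  rewrite -[X in coord_value _ _ X](_ : 1^-1 + 0 = 1); last first.
    by rewrite invr1 addr0.
  exact: coord_value0_le.
have lE : k%:R = l%:R + (k - l)%:R :> R by rewrite -natrD subnKC.
have ub3 : (1 - lam) `^ prior_b n k m alpha <= (1 - lam) `^ (N - 1).
  apply: ger_powR; first by rewrite subr_gt0 l1 gerBl ltW.
  rewrite /prior_b lerD2r lerDr.
  by rewrite divr_ge0// mulr_ge0// subr_ge0 ltW.
have etaE : eta `^ (shape_lam + N - 1) =
    eta `^ N * eta `^ a * (eta `^ (l%:R / 2) * eta `^ ((k - l)%:R / 2)).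
  rewrite -!powRD ?(gt_eqF e0) ?implybT//; congr powR.
  by rewrite /shape_lam lE; field.
have lamE : lam `^ (shape_lam - 1) =
    lam `^ a * (lam `^ (l%:R / 2) * lam `^ ((k - l)%:R / 2)).
  rewrite -!powRD ?(gt_eqF l0) ?implybT//; congr powR.
  by rewrite /shape_lam lE; field.
have ub4 : base_const n k m s 0 *
    (eta `^ (m%:R / 2 * 0) * eta `^ N * eta `^ a *
     (lam `^ a * (1 - lam) `^ prior_b n k m alpha)) *
    expR (- (eta / 2 * (s + 0 * residual Q 0))) <=
  base_const n k m s 0 * (eta `^ N * eta `^ a * (lam `^ a * (1 - lam) `^ (N - 1))) *
    expR (- (eta * (s / 2 + lam * 0))).
  rewrite mulr0 powRr0 mul1r mul0r mulr0 !addr0 (_ : eta / 2 * s = eta * (s / 2));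
    last by ring.
  rewrite ler_wpM2r ?expR_ge0// ler_wpM2l ?(ltW (base_const_gt0 m kn s0 0))//.
  by rewrite ler_wpM2l ?mulr_ge0 ?powR_ge0// ler_wpM2l ?powR_ge0.
have t1 : 0 <= \prod_i theta_value d Q alpha c v 0 0 i (eta, lam).
  apply: prodr_ge0 => i _; apply/ltW/coord_value_gt0 => //.
  exact: prior_theta_prec_gt0.
have t2 : 0 <= \prod_j mu_value gamma vstar j (eta, lam).
  by apply: prodr_ge0 => j _; apply/ltW/coord_value_gt0.
apply: (le_trans (ler_pM _ t2 (ler_pM _ t1 ub4 ub1) ub2)).
- rewrite mulr_ge0// mulr_ge0 ?expR_ge0// mulr_ge0 ?(ltW (base_const_gt0 _ _ _ _))//.
  by rewrite !mulr_ge0 ?powR_ge0.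
- rewrite mulr_ge0 ?expR_ge0// mulr_ge0 ?(ltW (base_const_gt0 _ _ _ _))//.
  by rewrite !mulr_ge0 ?powR_ge0.
rewrite /= etaE lamE /evidence_bound.
set CT := \prod_i _; set CM := \prod_(j < k - l) _; set B0 := base_const _ _ _ _ _.
clearbody CT CM B0; move: (expR _) => X.
by rewrite le_eqVlt; apply/orP; left; apply/eqP; ring.
Qed.

Lemma evidence_fin :
  (integral_psi (likelihood_prior n m d alpha a c gamma v vstar s) < +oo)%E.
Proof.
have N0 : 0 < N by exact: dimension_gt0.
have K0 : 0 <= evidence_bound.
  rewrite mulr_ge0 ?(ltW (base_const_gt0 _ _ _ _))//.
  by rewrite mulr_ge0// prodr_ge0// => i _; rewrite mulr_ge0 ?powR_ge0.
have mg := @measurable_gamma_beta_fun R shape_lam N (s / 2) 0.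
rewrite evidenceE; apply: (@le_lt_trans _ _ (\int[mu \x mu]_w
  (evidence_bound%:E * (gamma_beta_fun shape_lam N (s / 2) 0 w)%:E))%E).
  apply: ge0_le_integral => //.
  - by move=> w _; rewrite lee_fin evidence_fun_ge0.
  - by apply/measurable_EFinP; exact: measurable_evidence_fun.
  - apply/measurable_EFinP; apply: measurable_funM => //.
  - by move=> w _; rewrite -EFinM lee_fin evidence_fun_le.
rewrite ge0_integralZl_EFin//; last 2 first.
- by move=> w _; rewrite lee_fin gamma_beta_fun_ge0.
- exact/measurable_EFinP.
rewrite integral_gamma_beta_fun.
- by rewrite -EFinM ltry.
- exact: shape_lam_gt0.
- exact: N0.
- exact: divr_gt0.
- by rewrite addr0 divr_gt0.
Qed.

End marginal.

(** * Integrability of the Student kernel *)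

Section student.
Context {R : realType}.
Local Notation mu := (@lebesgue_measure R).

(** A Student kernel is a Gamma mixture of Gaussian kernels, which, unlike the kernel itself, factor
    over the coordinates. *)
Lemma powR_gamma_integral (p X s : R) : 0 < p -> 0 <= X -> 0 < s ->
  ((X + s) `^ (- p))%:E =
  (\int[mu]_x ((Gamma p)^-1 * gamma_fun p s x * expR (- (x * X)))%:E)%E.
Proof.
move=> p0 X0 s0; have G0 := Gamma_gt0 p0.
have E x : (Gamma p)^-1 * gamma_fun p s x * expR (- (x * X)) =
    (Gamma p)^-1 * gamma_fun p (X + s) x.
  have [x0|x0] := ltP 0 x; last by rewrite !gamma_fun0// !(mulr0, mul0r).
  rewrite !gamma_funE// -!mulrA -expRD; congr (_ * (_ * expR _)); ring.
under eq_integral => x _ do rewrite E EFinM.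
rewrite ge0_integralZl_EFin//; last 3 first.
- by move=> x _; rewrite lee_fin gamma_fun_ge0.
- by apply/measurable_EFinP; exact: measurable_gamma_fun.
- by rewrite invr_ge0 ltW.
rewrite integral_gamma_fun ?ltr_wpDl// -EFinM mulrA mulVf ?mul1r//.
by rewrite gt_eqF.
Qed.

(** Each Gaussian coordinate contributes x^(-1/2), so a Gamma integral of shape p - m/2 remains. *)
Lemma student_integral_fin m (h : 'cV[R]_m) (b s p : R) :
  0 < b -> 0 < s -> m%:R / 2 < p ->
  (integral_cV (fun y : 'cV[R]_m =>
     ((b * (\sum_i (y - h) i ord0 ^+ 2) + s) `^ (- p))%:E) < +oo)%E.
Proof.
move=> b0 s0 mp; have p0 : 0 < p by apply: le_lt_trans mp.
have G0 := Gamma_gt0 p0.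
pose r (x : R) := (Gamma p)^-1 * gamma_fun p s x.
pose f (i : 'I_m) (t x : R) := expR (- (x * (b * (t - h i ord0) ^+ 2))).
pose g (i : 'I_m) (x : R) := (pi / b) `^ 2^-1 * x `^ (- 2^-1).
have r0 x : 0 <= r x by rewrite mulr_ge0 ?gamma_fun_ge0// invr_ge0 ltW.
have rn0 x : r x != 0 -> 0 < x.
  by rewrite ltNge; apply: contraNN => x0; rewrite /r gamma_fun0// mulr0.
have T := @ge0_tonelli_tuple_prod _ (measurableTypeR R) R mu _ (measurableTypeR R)
  mu m r f g.
rewrite (_ : integral_cV _ = \int[tuple_measure mu m]_t \int[mu]_x
    (r x * \prod_i f i (tnth t i) x)%:E)%E; last first.
  apply: eq_integral => t _; rewrite powR_gamma_integral//; last first.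
    by rewrite mulr_ge0 ?(ltW b0)// sumr_ge0// => i _; rewrite sqr_ge0.
  apply: eq_integral => x _; congr (_ * _)%:E.
  rewrite -expR_sum; congr expR; rewrite sumrN mulrA !mulr_sumr.
  by congr (- _); apply: eq_bigr => i _; rewrite !mxE mulrA.
rewrite T//.
- have q0 : 0 < p - m%:R / 2 by rewrite subr_gt0.
  pose C := (Gamma p)^-1 * (pi / b) `^ 2^-1 ^+ m.
  have E x : r x * \prod_(i < m) g i x = C * gamma_fun (p - m%:R / 2) s x.
    rewrite /r /g; have [x0|x0] := ltP 0 x; last by rewrite !gamma_fun0// !(mulr0, mul0r).
    rewrite big_split/= !prodr_const card_ord -(powR_mulrn _ (powR_ge0 x _)) -powRrM.
    rewrite !gamma_funE//.
    have -> : x `^ (p - m%:R / 2 - 1) = x `^ (p - 1) * x `^ (- 2^-1 * m%:R).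
      rewrite -powRD; last by rewrite (gt_eqF x0) implybT.
      by congr powR; field.
    by rewrite /C; ring.
  under eq_integral => x _ do rewrite E EFinM.
  rewrite ge0_integralZl_EFin//; last 3 first.
  + by move=> x _; rewrite lee_fin gamma_fun_ge0.
  + by apply/measurable_EFinP; exact: measurable_gamma_fun.
  + by rewrite mulr_ge0 ?exprn_ge0 ?powR_ge0// invr_ge0 ltW.
  by rewrite integral_gamma_fun// -EFinM ltry.
- by apply: measurable_funM => //; exact: measurable_gamma_fun.
- move=> i; apply: measurableT_comp => //; apply: measurableT_comp => //.
  apply: measurable_funM => //; apply: measurable_funM => //.
  by apply: measurable_funX; exact: measurable_funB.
- by move=> i t x _; exact: expR_ge0.
- move=> i; apply: measurable_funM => //; exact: measurable_powR.
- move=> i x /rn0 x0.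
  have E t : f i t x = expR (- (2 * x * b / 2 * (t - h i ord0) ^+ 2)).
    by congr expR; field.
  under eq_integral => t _ do rewrite E.
  rewrite gaussian_integral ?mulr_gt0//; congr EFin.
  have pi0 : 0 < pi :> R by exact: pi_gt0.
  rewrite /g (_ : x `^ (- 2^-1) = x^-1 `^ 2^-1); last first.
    by rewrite -[in RHS](powR_inv1 (ltW x0)) -powRrM mulN1r.
  rewrite -powRM ?divr_ge0 ?invr_ge0 ?(ltW pi0) ?(ltW b0) ?(ltW x0)//.
  rewrite -powR12_sqrt; last by rewrite divr_ge0// ltW// !mulr_gt0.
  congr (_ `^ 2^-1); move: (pi) pi0 => P P0; field.
  by rewrite !gt_eqF.
Qed.

Lemma measurable_qform_col m (M : 'M[R]_m) (u : 'cV[R]_m) :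
  measurable_fun setT
    (fun t : m.-tuple (measurableTypeR R) => qform M ((\col_i tnth t i) - u)).
Proof.
rewrite (_ : (fun t => _) = (fun t : m.-tuple (measurableTypeR R) =>
   \sum_j (\sum_i (tnth t i - u i ord0) * M i j) * (tnth t j - u j ord0))).
  apply: measurable_sum => j; apply: measurable_funM; last first.
    by apply: measurable_funB => //; exact: measurable_tnth.
  apply: measurable_sum => i; apply: measurable_funM => //.
  by apply: measurable_funB => //; exact: measurable_tnth.
apply/funext => t; rewrite /qform mxE; apply: eq_bigr => j _; rewrite !mxE.
by congr (_ * _); apply: eq_bigr => i _; rewrite !mxE.
Qed.

End student.

(** * Normalization of the predictive density *)

Section predictive.
Context {R : realType}.
Variables (n k m l : nat).
Variables (d : 'rV[R]_l) (Q : 'M[R]_(m, l)) (alpha a : R) (c : 'rV[R]_l) (gamma : R).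
Variables (v : 'cV[R]_l) (vstar : 'cV[R]_(k - l)) (s : R).
Hypotheses (kn : (k < n)%N) (lk : (l <= k)%N).
Hypotheses (d0 : forall i, 0 < d ord0 i) (QQ : Q^T *m Q = 1%:M).
Hypotheses (alpha1 : alpha < 1) (c1 : forall i, 1 <= c ord0 i).
Hypotheses (gamma1 : 1 <= gamma) (s0 : 0 < s) (ha : - (k%:R / 2) - 1 < a).

Local Notation beta := ((1 - alpha) / 2).
Local Notation N := ((n - k)%:R / 2 : R).
Local Notation mu := (@lebesgue_measure R).
Local Notation U := (rate_U d Q alpha v s).
Local Notation B := (rate_B d Q alpha c gamma v vstar s).
Local Notation pred_U := (predictive_U n k d Q alpha v s).
Local Notation pred_B := (predictive_check d Q alpha a c gamma v vstar s).

Let U_gt0 y : 0 < U y.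
Proof. by apply: (lt_le_trans s0); exact: rate_U_ge. Qed.

Let B_ge y : s <= B y.
Proof.
rewrite rate_BE//; apply: (@le_trans _ _ (U y)); first exact: rate_U_ge.
by rewrite lerDl; exact: excess_ge0.
Qed.

Let B_gt0 y : 0 < B y.
Proof. by apply: (lt_le_trans s0); exact: B_ge. Qed.

Lemma bayes_kernelE : exists2 K : R, 0 < K & forall y,
  bayes_kernel n d Q alpha a c gamma v vstar s y = (K * (pred_U y * pred_B y))%:E.
Proof.
have b0 := beta_gt0 alpha1.
have Z0 : (0 < integral_psi (likelihood_prior n m d alpha a c gamma v vstar s))%E.
  exact: (evidence_gt0 a v vstar kn d0 QQ).
have Zoo : (integral_psi (likelihood_prior n m d alpha a c gamma v vstar s) < +oo)%E.
  exact: (evidence_fin v vstar kn lk d0 QQ).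
set Z := integral_psi _ in Z0 Zoo.
have ZE : Z = (fine Z)%:E by rewrite fineK// ge0_fin_numE// ltW.
have z0 : 0 < fine Z by rewrite -lte_fin -ZE.
pose A1 : R := shape_lam k a; pose A2 := shape_eta n k m beta.
have A10 : 0 < A1 by exact: shape_lam_gt0.
have A20 : 0 < A2 by exact/shape_eta_gt0/ltW.
(* The powers of 1/2 come from the rates [U y / 2] and [B y / 2]. *)
pose K0 := (fine Z)^-1 * (base_const n k m s beta * coord_const k d c gamma) *
  (Gamma A1 * Gamma A2) * (2^-1 `^ (- A2) * 2^-1 `^ (- A1)).
have K00 : 0 < K0.
  apply: mulr_gt0; last by rewrite mulr_gt0 ?powR_gt0.
  apply: mulr_gt0; last by rewrite mulr_gt0 ?Gamma_gt0.
  apply: mulr_gt0; first by rewrite invr_gt0.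
  by apply: mulr_gt0; [exact: base_const_gt0|exact: coord_const_gt0].
exists (K0 `^ beta^-1); first exact: powR_gt0.
move=> y; rewrite /bayes_kernel /posterior -/Z.
have V0 : 0 < (fine Z)^-1 by rewrite invr_gt0.
rewrite (_ : (Z^-1)%E = ((fine Z)^-1)%:E); last first.
  by rewrite ZE inver gt_eqF.
rewrite (hierarchical_integralE v vstar kn lk d0 QQ alpha1 c1 gamma1 s0 ha y V0).
rewrite poweR_EFin; congr EFin.
have U0 := U_gt0 y; have B0 := B_gt0 y.
have -> : (fine Z)^-1 * (base_const n k m s beta * coord_const k d c gamma) *
    (Gamma A1 * Gamma A2 * (U y / 2) `^ (- A2) * (B y / 2) `^ (- A1)) =
    K0 * (U y `^ (- A2) * B y `^ (- A1)).
  rewrite (powRM _ (ltW U0)) ?invr_ge0// (powRM _ (ltW B0)) ?invr_ge0//.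
  by rewrite /K0; ring.
rewrite inv_beta (powRM _ (ltW K00)) ?mulr_ge0 ?powR_ge0//; congr (_ * _).
rewrite powRM ?powR_ge0// -!powRrM /predictive_U /predictive_check.
have a0 : 1 - alpha != 0 by rewrite gt_eqF// subr_gt0.
congr (powR _ _ * powR _ _).
  by rewrite /A2 /shape_eta; field.
by rewrite /A1 /shape_lam; field.
Qed.

Lemma powRN_le (x y e : R) : 0 < x -> x <= y -> 0 <= e -> y `^ (- e) <= x `^ (- e).
Proof.
move=> x0 xy e0; have y0 := lt_le_trans x0 xy.
rewrite !powRN lef_pV2 ?posrE ?powR_gt0//.
by apply: ge0_ler_powR; rewrite // nnegrE ltW.
Qed.

(** A lower bound for the eigenvalues beta and beta / (1 + beta d_i) of the inverse of [Sigma_U],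
    with the sum of the d_i in place of their maximum. *)
Definition coercivity : R := beta / (1 + beta * \sum_i d ord0 i).

Lemma coercivity_gt0 : 0 < coercivity.
Proof.
have b0 := beta_gt0 alpha1; apply: divr_gt0 => //; apply: ltr_pwDl => //.
by rewrite mulr_ge0 ?(ltW b0)// sumr_ge0// => i _; exact: ltW.
Qed.

Lemma rate_U_coercive y :
  coercivity * (\sum_i (y - Q *m v) i ord0 ^+ 2) + s <= U y.
Proof.
have b0 := beta_gt0 alpha1.
have D0 : 0 <= \sum_i d ord0 i by apply: sumr_ge0 => i _; exact: ltW.
have D1 : 0 < 1 + beta * \sum_i d ord0 i by rewrite ltr_pwDl// mulr_ge0// ltW.
rewrite /rate_U lerD2r (qform_Sigma_U v y d0 QQ alpha1) (sum_sqr_split y v QQ).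
rewrite mulrDr lerD//.
  rewrite -/(residual Q y) ler_wpM2r ?residual_ge0// /coercivity.
  by rewrite ler_pdivrMr// ler_peMr ?(ltW b0)// lerDl mulr_ge0// ltW.
rewrite mulr_sumr; apply: ler_sum => i _.
have Di : d ord0 i <= \sum_i d ord0 i.
  by rewrite (bigD1 i)//= lerDl sumr_ge0// => j _; exact: ltW.
have d1 : 0 < 1 + beta * d ord0 i by rewrite addr_gt0// mulr_gt0.
rewrite /coercivity -sqrrN opprB mulrAC.
apply: ler_wpM2l; first by rewrite mulr_ge0 ?sqr_ge0// ltW.
rewrite lef_pV2 ?posrE//.
by rewrite lerD2l ler_wpM2l// ltW.
Qed.

Lemma measurable_rate_U : measurable_fun setT
  (fun t : m.-tuple (measurableTypeR R) => U (\col_i tnth t i)).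
Proof. by apply: measurable_funD => //; exact: measurable_qform_col. Qed.

Lemma measurable_rate_B : measurable_fun setT
  (fun t : m.-tuple (measurableTypeR R) => B (\col_i tnth t i)).
Proof.
do 3 apply: measurable_funD => //; exact: measurable_qform_col.
Qed.

Lemma measurable_predictive (K : R) : measurable_fun setT
  (fun t : m.-tuple (measurableTypeR R) =>
    (K * (pred_U (\col_i tnth t i) * pred_B (\col_i tnth t i)))%:E).
Proof.
apply/measurable_EFinP; apply: measurable_funM => //; apply: measurable_funM.
  exact: (measurableT_comp (measurable_powR _) measurable_rate_U).
exact: (measurableT_comp (measurable_powR _) measurable_rate_B).
Qed.

Lemma predictive_gt0 y : 0 < pred_U y * pred_B y.
Proof. by apply: mulr_gt0; apply: powR_gt0; [exact: U_gt0|exact: B_gt0]. Qed.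

Lemma integral_predictive_gt0 (K : R) : 0 < K ->
  (0 < integral_cV (fun y : 'cV[R]_m => (K * (pred_U y * pred_B y))%:E))%E.
Proof.
move=> K0; have mT : (0 < tuple_measure mu m setT)%E.
  apply: tuple_measureT_gt0.
  have muT : mu setT = +oo%E.
    by have := lebesgue_measure_itv (`]-oo, +oo[ : interval R); rewrite set_itvE.
  apply: (@lt_le_trans _ _ +oo%E); first exact: ltry.
  by rewrite le_eqVlt; apply/orP; left; apply/eqP/esym/muT.
apply: (ge0_integral_gt0 _ mT) => //.
- exact: measurable_predictive.
- by move=> t _; rewrite lte_fin mulr_gt0// predictive_gt0.
Qed.

Lemma integral_predictive_fin (K : R) : 0 < K ->
  (integral_cV (fun y : 'cV[R]_m => (K * (pred_U y * pred_B y))%:E) < +oo)%E.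
Proof.
move=> K0; have a0 : 0 < 1 - alpha by rewrite subr_gt0.
have b0 := beta_gt0 alpha1; have k0 := coercivity_gt0.
pose p : R := m%:R / 2 + (n - k)%:R / (1 - alpha).
pose e : R := (k%:R + 2 * a + 2) / (1 - alpha).
have p0 : 0 <= p by rewrite addr_ge0// divr_ge0// ltW.
have e0 : 0 <= e by apply: divr_ge0; [move: ha; lra|exact: ltW].
pose g (y : 'cV[R]_m) := (coercivity * (\sum_i (y - Q *m v) i ord0 ^+ 2) + s) `^ (- p).
(* Since B >= s and e >= 0, the second factor is bounded. The first lies below a Student kernel
   whose exponent exceeds m/2 by (n - k) / (1 - alpha) > 0. *)
have ub y : K * (pred_U y * pred_B y) <= K * s `^ (- e) * g y.
  rewrite -mulrA ler_wpM2l ?(ltW K0)// mulrC.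
  apply: ler_pM; rewrite ?powR_ge0//.
    by apply: powRN_le => //; exact: B_ge.
  rewrite /predictive_U /g -opprD; apply: powRN_le => //.
    rewrite ltr_wpDl// mulr_ge0 ?(ltW k0)// sumr_ge0// => i _.
    exact: sqr_ge0.
  exact: rate_U_coercive.
have mg : measurable_fun setT
    (fun t : m.-tuple (measurableTypeR R) => (g (\col_i tnth t i))%:E).
  apply/measurable_EFinP; apply: (measurableT_comp (measurable_powR _)).
  apply: measurable_funD => //; apply: measurable_funM => //.
  apply: measurable_sum => i; apply: measurable_funX.
  under eq_fun do rewrite !mxE.
  by apply: measurable_funB => //; exact: measurable_tnth.
apply: (@le_lt_trans _ _ ((K * s `^ (- e))%:E * integral_cV (fun y => (g y)%:E))%E).
  rewrite /integral_cV -ge0_integralZl_EFin//.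
  - apply: ge0_le_integral => //.
    + by move=> t _; rewrite lee_fin mulr_ge0 ?(ltW K0)// ltW// predictive_gt0.
    + exact: measurable_predictive.
    + apply/measurable_EFinP; apply: measurable_funM; first exact: measurable_cst.
      exact/measurable_EFinP.
    + by move=> t _; rewrite -EFinM lee_fin.
  - by move=> t _; rewrite lee_fin powR_ge0.
  - by rewrite mulr_ge0 ?powR_ge0// ltW.
apply: lte_mul_pinfty => //.
- by rewrite lee_fin mulr_ge0 ?powR_ge0// ltW.
- by apply: student_integral_fin => //; rewrite ltrDl divr_gt0// ltr0n subn_gt0.
Qed.

End predictive.

Theorem theorem3p1 (R : realType) (n k m l : nat)
  (hk : (1 <= k)%N) (hkn : (k < n)%N) (hm : (1 <= m)%N) (hl : l = minn k m)
  (d : 'rV[R]_l) (hd_pos : forall i, 0 < d ord0 i)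
  (hd_mono : forall i j : 'I_l, (i <= j)%N -> d ord0 j <= d ord0 i)
  (Q : 'M[R]_(m, l)) (hQ : Q^T *m Q = 1%:M)
  (alpha : R) (halpha : -1 <= alpha < 1)
  (a : R) (ha : - (k%:R / 2) - 1 < a)
  (c : 'rV[R]_l) (hc : forall i, 1 <= c ord0 i)
  (gamma : R) (hgamma : 1 <= gamma)
  (v : 'cV[R]_l) (vstar : 'cV[R]_(k - l)) (s : R) (hs : 0 < s) :
  exists2 K : R, 0 < K &
    forall y : 'cV[R]_m,
      bayes_predictive n d Q alpha a c gamma v vstar s y =
      (K * (predictive_U n k d Q alpha v s y *
            predictive_check d Q alpha a c gamma v vstar s y))%:E.
Proof.
have /andP[_ alpha1] := halpha.
have lk : (l <= k)%N by rewrite hl geq_minl.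
have [K K0 kerE] := bayes_kernelE v vstar hkn lk hd_pos hQ alpha1 hc hgamma hs ha.
pose I := integral_cV (bayes_kernel n d Q alpha a c gamma v vstar s).
have IE : I = integral_cV (fun y : 'cV[R]_m =>
    (K * (predictive_U n k d Q alpha v s y *
          predictive_check d Q alpha a c gamma v vstar s y))%:E).
  by congr integral_cV; apply/funext => y; exact: kerE.
(* Both bounds are needed for the division by [I] to be an ordinary real division by a positive
   number. *)
have I0 : (0 < I)%E by rewrite IE; exact: integral_predictive_gt0.
have Ioo : (I < +oo)%E by rewrite IE; exact: integral_predictive_fin.
have IfE : I = (fine I)%:E by rewrite fineK// ge0_fin_numE// ltW.
have i0 : 0 < fine I by rewrite -lte_fin -IfE.
exists (K / fine I); first exact: divr_gt0.
move=> y; rewrite /bayes_predictive kerE -/I IfE inver gt_eqF// -EFinM.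
by congr EFin; rewrite mulrAC.
Qed.
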